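(* Let $f\colon\mathbb C\to\mathbb C$ be an entire transcendental function, let $\delta\in\mathbb C\setminus\{0\}$, and let $F(z,w)=(f(z)-\delta w,\,z)$ be the associated transcendental Hénon map of $\mathbb C^2$. Let $P_0\in\mathbb C^2$ be an Eremenko escaping point of $F$. Then there exists an injective holomorphic immersion $\gamma\colon\mathbb C\to\mathbb C^2$ whose image $\Sigma^s(P_0)$ contains $P_0$ and is contained in the escaping set $I(F)$. Moreover, for every $Q\in\Sigma^s(P_0)$, $\|F^n(Q)-F^n(P_0)\|$ converges to zero at least exponentially fast as $n\to\infty$, i.e. there exist $C>0$ and $0<\lambda<1$ with $\|F^n(Q)-F^n(P_0)\|\le C\lambda^n$ for all $n\ge 0$.
   Context: The escaping set is $I(F)=\{p\in\mathbb C^2:\ \|F^n(p)\|\to\infty\}$. An entire function is transcendental if it is not a polynomial. Wiman-Valiron notation. Write $f(z)=\sum_{n\ge0}a_nz^n$. For $r>0$ let $M(r)=\max_{|z|=r}|f(z)|$, and let $N(r)$ (the central index) be the largest index $n$ for which $|a_n|r^n$ is maximal. A point of maximum modulus for $r$ is a point $\zeta_r$ with $|\zeta_r|=r$ and $|f(\zeta_r)|=M(r)$. A set $E\subset(0,\infty)$ has finite logarithmic measure if $\int_{E\cap[1,\infty)}dt/t<\infty$. By the Wiman-Valiron theorem (with exponent $2/3$) there is a set $E$ of finite logarithmic measure such that, for $z$ in the disk $|z-\zeta_r|<r/N(r)^{2/3}$, $$f(z)=\Big(\frac{z}{\zeta_r}\Big)^{N(r)}f(\zeta_r)(1+\epsilon_0),\qquad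 f'(z)=\frac{N(r)}{\zeta_r}f(z)(1+\epsilon_1),$$ where $\epsilon_0,\epsilon_1$ are functions tending to $0$ uniformly in $z$ as $r\to\infty$, $r\notin E$. Fix such an $E$. For $r>0$ and a point $\zeta$ with $|\zeta|=r$ put $$D(r,\zeta)=\{z:\ re^{-2/N(r)}<|z|<re^{2/N(r)},\ |\mathrm{Arg}(z)-\mathrm{Arg}(\zeta)|<4\pi/N(r)\},$$ with the difference of arguments taken modulo $2\pi$ in $(-\pi,\pi]$. For $X\subset\mathbb C$ let $\mathcal N_\delta(X)$ be the $|\delta|$-neighborhood of $X$. Choice of $R$. Let $R>0$ be such that: (i) $|\log(1+\epsilon_0)|<\frac12$ and $|\epsilon_0|\le\frac12$ for all $r\ge R$, $r\notin E$; (ii) $|\epsilon_1|<\frac12$ for all $r\ge R$, $r\notin E$; (iii) $M(r)/r\ge K$ for all $r\ge R$, where $K$ is a fixed sufficiently large constant depending only on $f$ and $\delta$ (its role is to make the inductive construction below possible; the properties of the construction it guarantees are listed explicitly below); (iv) $E\cap[R,\infty)$ has logarithmic measure $\le1$; (v) $N(R)>8$; (vi) for all $r\ge R$ and all $\zeta_r$ with $|\zeta_r|=r$, $D(r,\zeta_r)\subset\{|z-\zeta_r|<r/N(r)^{2/3}\}$. Eremenko construction. Consider a sequence of radii $r_n\ge R$, $n\ge0$, $r_n\notin E$, increasing to $\infty$, with $M_n=M(r_n)$, $N_n=N(r_n)$, points $\zeta_n$ of maximum modulus for $r_n$, domains $D_n=D(r_n,\zeta_n)$, and annuli $A_{n}=\{M_{n-1}/e<|z|<M_{n-1}e\}$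 for $n\ge1$, such that $D_n$ is compactly contained in $A_n$ and $\mathcal N_\delta(D_n)\subset A_n$ for all $n\ge1$; and, with $\varphi_0:=0$ on $D_0$, univalent holomorphic maps $\varphi_{n}\colon\mathcal N_\delta(D_{n})\to D_{n-1}$, $n\ge1$, such that: (a) $(f-\delta\varphi_n)(D_n)\supset A_{n+1}$ for all $n\ge0$; (b) $\varphi_{n+1}$ is an inverse branch of $f-\delta\varphi_n$, i.e. $(f-\delta\varphi_n)(\varphi_{n+1}(w))=w$ for all $w\in\mathcal N_\delta(D_{n+1})$ and all $n\ge0$; (c) $|\varphi_n'|\le1$ on $D_n$ for all $n\ge1$. Let $\Gamma_n=\{(z,\varphi_n(z)):z\in D_n\}\subset\mathbb C^2$, $n\ge0$. Then $F^{-1}(\Gamma_n)$ is relatively compact in $\Gamma_{n-1}$, the set $\bigcap_{n\ge0}F^{-n}(\Gamma_n)$ is non-empty, and it consists of escaping points. An Eremenko escaping point of $F$ is a point $P_0\in\bigcap_{n\ge0}F^{-n}(\Gamma_n)$ arising from such a construction. *)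

(* Defs.v *)
From mathcomp Require all_boot all_order all_algebra all_classical all_reals.
From mathcomp Require measure measurable_realfun lebesgue_measure lebesgue_integral Rstruct.
From Stdlib Require Import Reals List.
From Coquelicot Require Import Coquelicot.

(* MathComp-Analysis is used only for Lebesgue integration on the Stdlib reals;
   its notations are confined to this module. *)
Module LogMeasure.
Import all_boot all_order all_algebra all_classical all_reals.
Import measure measurable_realfun lebesgue_measure lebesgue_integral Rstruct.

Definition borel (X : R -> Prop) : Prop := @measurable _ (measurableTypeR R) X.

Definition log_measure (X : R -> Prop) : \bar R :=
  (\int[@lebesgue_measure R]_(t in (X : set R)) (GRing.inv t)%:E)%E.

Definition log_measure_le (X : R -> Prop) (c : R) : Prop :=
  (log_measure X <= c%:E)%E.

Definition finite_log_measure (E : R -> Prop) : Prop :=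
  borel E /\
  (log_measure (fun t : R => E t /\ Rle (IZR 1) t) < +oo)%E.
End LogMeasure.

Open Scope R_scope.

(* C^2, with the Euclidean norm as its library norm. *)
Definition C2 : NormedModule C_AbsRing :=
  prod_NormedModule C_AbsRing C_NormedModule C_NormedModule.

Definition holomorphic_on (U : C -> Prop) (g : C -> C) : Prop :=
  forall z, U z -> @ex_derive C_AbsRing C_NormedModule g z.

Definition univalent_on (U : C -> Prop) (g : C -> C) : Prop :=
  holomorphic_on U g /\ forall z w, U z -> U w -> g z = g w -> z = w.

Definition entire (f : C -> C) : Prop := holomorphic_on (fun _ => True) f.

Definition polynomial_fun (f : C -> C) : Prop :=
  exists (n : nat) (c : nat -> C),
    forall z : C, f z = sum_n (fun k => Cmult (c k) (Cpow z k)) n.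

Definition entire_transcendental (f : C -> C) : Prop :=
  entire f /\ ~ polynomial_fun f.

Definition henon (f : C -> C) (delta : C) (p : C2) : C2 :=
  (Cminus (f (fst p)) (Cmult delta (snd p)), fst p).

Definition escaping_set (F : C2 -> C2) (p : C2) : Prop :=
  is_lim_seq (fun n => norm (Nat.iter n F p)) p_infty.

Definition injective_holomorphic_immersion (gamma : C -> C2) : Prop :=
  (forall s t, gamma s = gamma t -> s = t) /\
  forall t, exists v : C2, @is_derive C_AbsRing C2 gamma t v /\ v <> zero.

(* Principal value in (-PI, PI], for z <> 0. *)
Definition Arg (z : C) : R :=
  if Rle_dec 0 (Im z) then acos (Re z / Cmod z) else - acos (Re z / Cmod z).

Definition Clog (z : C) : C := (ln (Cmod z), Arg z).

Definition closure (X : C -> Prop) (z : C) : Prop :=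
  forall eps : posreal, exists x, X x /\ Cmod (Cminus x z) < eps.

Definition compact_set (X : C -> Prop) : Prop :=
  forall (I : Type) (U : I -> C -> Prop),
    (forall i, open (U i)) ->
    (forall z, X z -> exists i, U i z) ->
    exists l : list I, forall z, X z -> exists i, In i l /\ U i z.

Definition compactly_contained (X Y : C -> Prop) : Prop :=
  compact_set (closure X) /\ forall z, closure X z -> Y z.

Definition neighborhood (delta : C) (X : C -> Prop) (z : C) : Prop :=
  exists x, X x /\ Cmod (Cminus z x) < Cmod delta.

Definition taylor_coefficients (f : C -> C) (a : nat -> C) : Prop :=
  forall z : C, @is_pseries C_AbsRing C_NormedModule a z (f z).

Definition is_max_modulus (f : C -> C) (r m : R) : Prop :=
  (exists z, Cmod z = r /\ Cmod (f z) = m) /\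
  (forall z, Cmod z = r -> Cmod (f z) <= m).

Definition is_central_index (a : nat -> C) (r : R) (n : nat) : Prop :=
  (forall k, Cmod (a k) * r ^ k <= Cmod (a n) * r ^ n) /\
  (forall k, (n < k)%nat -> Cmod (a k) * r ^ k < Cmod (a n) * r ^ n).

Definition max_modulus_point (f : C -> C) (M : R -> R) (r : R) (zeta : C) : Prop :=
  Cmod zeta = r /\ Cmod (f zeta) = M r.

Definition wv_disk (N : R -> nat) (r : R) (zeta z : C) : Prop :=
  Cmod (Cminus z zeta) < r / Rpower (INR (N r)) (2 / 3).

(* [M] and [N] are the maximum modulus and the central index of [f], [E] is an
   exceptional set, and [eps0 r zeta z], [eps1 r zeta z] are the error terms,
   for [zeta] a point of maximum modulus for [r]. *)
Record wiman_valiron (f : C -> C) (a : nat -> C) (M : R -> R) (N : R -> nat)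
    (E : R -> Prop) (eps0 eps1 : R -> C -> C -> C) : Prop := {
  wv_taylor : taylor_coefficients f a;
  wv_max_modulus : forall r, 0 < r -> is_max_modulus f r (M r);
  wv_central_index : forall r, 0 < r -> is_central_index a r (N r);
  wv_exceptional_pos : forall r, E r -> 0 < r;
  wv_exceptional_finite : LogMeasure.finite_log_measure E;
  wv_f : forall r zeta z, 0 < r -> ~ E r ->
    max_modulus_point f M r zeta -> wv_disk N r zeta z ->
    f z = Cmult (Cmult (Cpow (Cdiv z zeta) (N r)) (f zeta))
                (Cplus (RtoC 1) (eps0 r zeta z));
  wv_derive_f : forall r zeta z, 0 < r -> ~ E r ->
    max_modulus_point f M r zeta -> wv_disk N r zeta z ->
    @is_derive C_AbsRing C_NormedModule f z
      (Cmult (Cmult (Cdiv (RtoC (INR (N r))) zeta) (f z))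
             (Cplus (RtoC 1) (eps1 r zeta z)));
  wv_eps : forall eta, 0 < eta -> exists r0, forall r zeta z,
    r0 <= r -> 0 < r -> ~ E r ->
    max_modulus_point f M r zeta -> wv_disk N r zeta z ->
    Cmod (eps0 r zeta z) < eta /\ Cmod (eps1 r zeta z) < eta
}.

Definition sector_domain (N : R -> nat) (r : R) (zeta z : C) : Prop :=
  (r * exp (- (2 / INR (N r))) < Cmod z < r * exp (2 / INR (N r))) /\
  exists k : Z,
    let d := Arg z - Arg zeta + 2 * PI * IZR k in
    - PI < d <= PI /\ Rabs d < 4 * PI / INR (N r).

Record radius_choice (f : C -> C) (M : R -> R) (N : R -> nat) (E : R -> Prop)
    (eps0 eps1 : R -> C -> C -> C) (K R0 : R) : Prop := {
  rc_pos : 0 < R0;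
  rc_eps0 : forall r zeta z, R0 <= r -> ~ E r ->
    max_modulus_point f M r zeta -> wv_disk N r zeta z ->
    Cmod (Clog (Cplus (RtoC 1) (eps0 r zeta z))) < 1 / 2 /\
    Cmod (eps0 r zeta z) <= 1 / 2;
  rc_eps1 : forall r zeta z, R0 <= r -> ~ E r ->
    max_modulus_point f M r zeta -> wv_disk N r zeta z ->
    Cmod (eps1 r zeta z) < 1 / 2;
  rc_growth : forall r, R0 <= r -> K <= M r / r;
  rc_log_measure : LogMeasure.log_measure_le (fun t => E t /\ R0 <= t) 1;
  rc_central_index : (8 < N R0)%nat;
  rc_domain : forall r zeta z, R0 <= r -> Cmod zeta = r ->
    sector_domain N r zeta z -> wv_disk N r zeta z
}.

Definition eremenko_D (N : R -> nat) (r : nat -> R) (zeta : nat -> C) (n : nat) :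
    C -> Prop :=
  sector_domain N (r n) (zeta n).

(* Meaningful for n >= 1 only. *)
Definition eremenko_A (M : R -> R) (r : nat -> R) (n : nat) (z : C) : Prop :=
  M (r (Nat.pred n)) / exp 1 < Cmod z < M (r (Nat.pred n)) * exp 1.

Definition eremenko_graph (N : R -> nat) (r : nat -> R) (zeta : nat -> C)
    (phi : nat -> C -> C) (n : nat) (p : C2) : Prop :=
  eremenko_D N r zeta n (fst p) /\ snd p = phi n (fst p).

(* Only the values of [phi n] on the [delta]-neighborhood of the n-th domain
   (on the domain itself for n = 0) are constrained. *)
Record eremenko_construction (f : C -> C) (delta : C) (M : R -> R) (N : R -> nat)
    (E : R -> Prop) (R0 : R) (r : nat -> R) (zeta : nat -> C)
    (phi : nat -> C -> C) : Prop := {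
  er_radius : forall n, R0 <= r n;
  er_not_exceptional : forall n, ~ E (r n);
  er_increasing : forall n, r n < r (S n);
  er_unbounded : is_lim_seq r p_infty;
  er_max_modulus : forall n, max_modulus_point f M (r n) (zeta n);
  er_D_in_A : forall n, (1 <= n)%nat ->
    compactly_contained (eremenko_D N r zeta n) (eremenko_A M r n);
  er_neighborhood_in_A : forall n, (1 <= n)%nat ->
    forall z, neighborhood delta (eremenko_D N r zeta n) z ->
      eremenko_A M r n z;
  er_phi0 : forall z, eremenko_D N r zeta 0%nat z -> phi 0%nat z = RtoC 0;
  er_phi_univalent : forall n, (1 <= n)%nat ->
    univalent_on (neighborhood delta (eremenko_D N r zeta n)) (phi n);
  er_phi_maps : forall n w,
    neighborhood delta (eremenko_D N r zeta (S n)) w ->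
    eremenko_D N r zeta n (phi (S n) w);
  er_cover : forall n w, eremenko_A M r (S n) w ->
    exists z, eremenko_D N r zeta n z /\ Cminus (f z) (Cmult delta (phi n z)) = w;
  er_inverse_branch : forall n w,
    neighborhood delta (eremenko_D N r zeta (S n)) w ->
    Cminus (f (phi (S n) w)) (Cmult delta (phi n (phi (S n) w))) = w;
  er_phi_derive : forall n z, (1 <= n)%nat -> eremenko_D N r zeta n z ->
    Cmod (C_derive (phi n) z) <= 1
}.

Definition eremenko_escaping_point (f : C -> C) (delta : C) (K : R) (P0 : C2) : Prop :=
  exists (a : nat -> C) (M : R -> R) (N : R -> nat) (E : R -> Prop)
         (eps0 eps1 : R -> C -> C -> C) (R0 : R)
         (r : nat -> R) (zeta : nat -> C) (phi : nat -> C -> C),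
    wiman_valiron f a M N E eps0 eps1 /\
    radius_choice f M N E eps0 eps1 K R0 /\
    eremenko_construction f delta M N E R0 r zeta phi /\
    forall n, eremenko_graph N r zeta phi n (Nat.iter n (henon f delta) P0).

(* Main.v *)
(* The orbit of P_0 is (x_(n+1), x_n) with x_(n+2) = f(x_(n+1)) - delta x_n, and the
   Wiman-Valiron estimates make lam_n = f'(x_(n+1)) grow at least like 4^n, with f under
   control on a disk of radius rho_n = r_n / N(r_n) around x_(n+1). Put
   p_n = prod_(k < n) delta / lam_k. In the rescaled coordinates y_n = x_n + p_n Y_n the
   recursion reads Y_n = G_n(Y_(n+1)) - kap_n Y_(n+2) with G_n(0) = 0, G_n'(0) = 1 and
   kap_n small; by Cauchy's estimate G_n is so close to the identity that for every t in C
   there is exactly one solution with Y_n -> t. The stable manifold is parametrized by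
   this limit t: gamma(t) = (y_1, y_0). It is injective because an orbit determines its
   limit; the derivative of Y in t is the solution of the linearized recursion with
   limit 1, which cannot vanish at two consecutive indices. Finally y_n - x_n = p_n Y_n
   decays like 4^(-n).

   Cauchy's estimate is obtained from the Taylor series of f by averaging its partial
   sums over roots of unity. *)
Require Import Defs.
From Stdlib Require Import Reals Lra Lia Psatz Arith ZArith ClassicalEpsilon.
From Coquelicot Require Import Coquelicot.
Open Scope R_scope.

(** * Complex derivatives *)

(** A stable orbit is prescribed by its behaviour at infinity, and the limit t of the rescaled
    coordinate is that datum. On a ball |Y| <= T the nonlinear error at index n is O(T 4^(-n)), so
    for each T the recursion is harmless from some index m(T) on. It is solved there from infinity
    downwards; the finitely many indices below m(T) are then filled in by the recursion itself,
    which gives Y_n explicitly from Y_(n+1) and Y_(n+2). Every t in C is reached because T is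
    arbitrary. The decay 4^(-n) is spent as 2^(-n) 2^(-n): one factor absorbs constants depending on
    T, the other keeps the accumulated errors summable.

    The growth of lam_n has three sources: on D_n the quantity |f'| r_n / N(r_n) is at least a
    constant times M(r_n); M(r) >= c r^2 for large r because f is not affine; and r_(n+1) >= 4 r_n
    because D_(n+1) lies in A_(n+1) and K >= 4e. Together they give |lam_n| >= const r_n >= const
    4^n. *)

Ltac Cring :=
  unfold Cminus, minus, plus, opp, scal, mult, zero, one; simpl;
  unfold Cminus, minus, plus, opp, scal, mult, zero, one; simpl;
  match goal with |- @eq _ ?a ?b => change (@eq C a b) end; ring.

(** Differentiability without division by h, so that the quantitative second-order estimates below
    apply to it directly. *)
Definition cderiv (g : C -> C) (z l : C) : Prop :=
  forall eps, 0 < eps -> exists d, 0 < d /\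
    forall h, Cmod h < d ->
      Cmod (g (z + h) - g z - l * h)%C <= eps * Cmod h.

Lemma is_derive_cderiv (g : C -> C) (z l : C) :
  @is_derive C_AbsRing C_NormedModule g z l -> cderiv g z l.
Proof.
intros [_ H] eps He.
destruct (H z (fun P HP => HP) (mkposreal eps He)) as [d Hd].
exists d; split; [apply cond_pos|]; intros h Hh.
specialize (Hd (z + h)%C).
replace (Cmod h) with (Cmod (minus (z+h)%C z)).
2:{ f_equal. Cring. }
eapply Rle_trans; [|apply Hd].
- apply Req_le. unfold norm; simpl. f_equal. Cring.
- unfold ball; simpl. unfold AbsRing_ball, abs; simpl.
  match goal with |- Cmod ?u < _ => replace u with h end; [exact Hh|Cring].
Qed.

Lemma cderiv_pair_is_derive (g1 g2 : C -> C) (z l1 l2 : C) :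
  cderiv g1 z l1 -> cderiv g2 z l2 ->
  @is_derive C_AbsRing (prod_NormedModule C_AbsRing C_NormedModule C_NormedModule)
    (fun t => (g1 t, g2 t)) z (l1, l2).
Proof.
intros H1 H2. split.
- apply is_linear_scal_l.
- intros x Hx eps.
  assert (Hz : z = x).
  { apply (@is_filter_lim_locally_unique C_AbsRing (AbsRing_NormedModule C_AbsRing) z x Hx). }
  subst x.
  destruct (H1 (eps/2)) as [d1 [Hd1 K1]]. { destruct eps; simpl; lra. }
  destruct (H2 (eps/2)) as [d2 [Hd2 K2]]. { destruct eps; simpl; lra. }
  assert (Hd : 0 < Rmin d1 d2) by (apply Rmin_glb_lt; assumption).
  exists (mkposreal _ Hd). intros y Hy.
  unfold ball in Hy; simpl in Hy. unfold AbsRing_ball, abs in Hy; simpl in Hy.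
  set (h := minus y z) in *.
  assert (Ey : y = (z + h)%C).
  { assert (key : forall a b : C, a = (b + (a - b))%C) by (intros; ring). apply key. }
  change (norm h) with (Cmod h).
  assert (L1 := K1 h (Rlt_le_trans _ _ _ Hy (Rmin_l _ _))).
  assert (L2 := K2 h (Rlt_le_trans _ _ _ Hy (Rmin_r _ _))).
  rewrite <- Ey in L1, L2.
  unfold norm; simpl. unfold prod_norm. simpl.
  set (a := (g1 y - g1 z - l1 * h)%C) in *.
  set (b := (g2 y - g2 z - l2 * h)%C) in *.
  match goal with |- sqrt (norm ?u * (norm ?u * 1) + norm ?v * (norm ?v * 1)) <= _ =>
    replace u with a; [replace v with b|] end.
  + change (sqrt (Cmod a * (Cmod a * 1) + Cmod b * (Cmod b * 1)) <= eps * Cmod h).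
    assert (Ha := Cmod_ge_0 a). assert (Hb := Cmod_ge_0 b). assert (Hh := Cmod_ge_0 h).
    assert (He := cond_pos eps).
    apply Rle_trans with (Cmod a + Cmod b); [|lra].
    rewrite <- (sqrt_Rsqr (Cmod a + Cmod b)) by lra.
    apply sqrt_le_1_alt. unfold Rsqr. nra.
  + unfold b, h. Cring.
  + unfold a, h. Cring.
Qed.

(** * Cauchy's estimate *)

Ltac Cring_weak :=
  change (@zero C_AbelianMonoid) with (RtoC 0) in *;
  match goal with |- @eq _ ?a ?b => change (@eq C a b) end; ring.

Definition polyC (c : nat -> C) (d : nat) (z : C) : C :=
  sum_n (fun k => Cmult (c k) (Cpow z k)) d.

Lemma polyC_0 c z : polyC c 0 z = c 0%nat.
Proof. unfold polyC. rewrite sum_O. simpl. ring. Qed.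

Lemma polyC_S c d z : polyC c (S d) z = (polyC c d z + c (S d) * z ^ S d)%C.
Proof. unfold polyC. rewrite sum_Sn. reflexivity. Qed.

Lemma polyC_ext c c' d z : (forall k, (k <= d)%nat -> c k = c' k) -> polyC c d z = polyC c' d z.
Proof. intros H. apply sum_n_ext_loc. intros k Hk. now rewrite H. Qed.

(** The test [le_dec k d] discards [c (S d)], since [c] is an arbitrary sequence and only its first
    d + 1 values enter the product. *)
Lemma polyC_mul_linear c d x u :
  ((x + u) * polyC c d u)%C =
  polyC (fun k => x * (if le_dec k d then c k else 0) + match k with 0 => 0 | S j => c j end)%C
    (S d) u.
Proof.
set (g := fun d k => (x * (if le_dec k d then c k else 0) + match k with 0 => 0 | S j => c j end)%C).
change (((x + u) * polyC c d u)%C = polyC (g d) (S d) u).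
induction d as [|d IH].
- rewrite polyC_S, !polyC_0. unfold g. simpl. ring.
- rewrite (polyC_S c), Cmult_plus_distr_l, IH, !polyC_S.
  rewrite (polyC_ext (g (S d)) (g d) d).
  2:{ intros k Hk. unfold g. destruct (le_dec k (S d)), (le_dec k d); try lia; ring. }
  unfold g.
  destruct (le_dec (S d) d), (le_dec (S d) (S d)), (le_dec (S (S d)) (S d)); try lia.
  rewrite !Cpow_S. ring.
Qed.

Lemma polyC_add c c' d z :
  (polyC c d z + polyC c' d z)%C = polyC (fun k => c k + c' k)%C d z.
Proof.
induction d as [|d IH]; [rewrite !polyC_0; ring|].
rewrite !polyC_S, <- IH. ring.
Qed.

Lemma polyC_scal a c d z :
  (a * polyC c d z)%C = polyC (fun k => a * c k)%C d z.
Proof.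
induction d as [|d IH]; [rewrite !polyC_0; ring|].
rewrite !polyC_S, <- IH. ring.
Qed.

Lemma Cpow_shift x d : exists c, forall u, ((x + u) ^ d)%C = polyC c d u.
Proof.
induction d as [|d [c IH]].
- exists (fun _ => RtoC 1). intro u. now rewrite polyC_0.
- eexists. intro u. rewrite Cpow_S, IH. apply polyC_mul_linear.
Qed.

(** Recentring at x lets Cauchy's estimate, proved for circles around 0, be used around any
    point. *)
Lemma polyC_shift c d x : exists c', forall u, polyC c d (x + u) = polyC c' d u.
Proof.
induction d as [|d [c' IH]].
- exists c. intro u. now rewrite !polyC_0.
- destruct (Cpow_shift x (S d)) as [e He].
  exists (fun k => (if le_dec k d then c' k else 0) + c (S d) * e k)%C. intro u.
  rewrite polyC_S, IH, He, <- polyC_add, <- (polyC_scal (c (S d))). f_equal.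
  rewrite (polyC_S _ d). destruct (le_dec (S d) d); [lia|].
  rewrite (polyC_ext (fun k => if le_dec k d then c' k else RtoC 0) c' d).
  + ring.
  + intros k Hk. destruct (le_dec k d); [reflexivity|lia].
Qed.

Definition unit_root (m : nat) : C := (cos (2 * PI / INR m), sin (2 * PI / INR m)).

Lemma unit_root_pow m j :
  (unit_root m ^ j)%C = (cos (INR j * (2 * PI / INR m)), sin (INR j * (2 * PI / INR m))).
Proof.
induction j as [|j IH].
- simpl. rewrite Rmult_0_l, cos_0, sin_0. reflexivity.
- rewrite Cpow_S, IH, S_INR. unfold unit_root.
  set (t := 2 * PI / INR m).
  replace ((INR j + 1) * t) with (t + INR j * t) by ring.
  rewrite cos_plus, sin_plus. unfold Cmult; simpl. f_equal; ring.
Qed.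

Lemma Cmod_unit_root_pow m j : Cmod (unit_root m ^ j) = 1.
Proof.
rewrite unit_root_pow. unfold Cmod; simpl.
set (t := INR j * _). rewrite !Rmult_1_r.
assert (H := sin2_cos2 t). unfold Rsqr in H.
replace (_ + _) with 1 by lra. apply sqrt_1.
Qed.

Lemma unit_root_pow_m m : (0 < m)%nat -> (unit_root m ^ m)%C = 1.
Proof.
intros Hm. rewrite unit_root_pow.
assert (0 < INR m) by (apply lt_0_INR; lia).
replace (INR m * (2 * PI / INR m)) with (2 * PI) by (field; lra).
now rewrite cos_2PI, sin_2PI.
Qed.

Lemma unit_root_neq_0 m : unit_root m <> 0.
Proof.
apply Cmod_gt_0. rewrite <- (Cpow_1_r (unit_root m)), Cmod_unit_root_pow. lra.
Qed.

(** The real part is cos(2s) = 1 - 2 sin(s)^2 with s = pi l / m strictly between 0 and pi, hence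
    less than 1. *)
Lemma unit_root_pow_neq_1 m l : (0 < l < m)%nat -> (unit_root m ^ l)%C <> 1.
Proof.
intros [Hl Hm] H. rewrite unit_root_pow in H.
apply (f_equal fst) in H. simpl in H.
assert (0 < INR l) by (apply lt_0_INR; lia).
assert (0 < INR m) by (apply lt_0_INR; lia).
assert (INR l < INR m) by (apply lt_INR; lia).
set (s := INR l / INR m * PI).
replace (INR l * (2 * PI / INR m)) with (2 * s) in H by (unfold s; field; lra).
rewrite cos_2a_sin in H.
assert (HP := PI_RGT_0).
assert (0 < INR l / INR m < 1).
{ split; [apply Rdiv_lt_0_compat; lra|]. apply Rmult_lt_reg_r with (INR m); [lra|].
  unfold Rdiv. rewrite Rmult_assoc, Rinv_l; lra. }
assert (0 < sin s) by (apply sin_gt_0; unfold s; nra).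
nra.
Qed.

Lemma unit_root_pow_neq m i k : (i <= k)%nat -> (k < m)%nat -> i <> k ->
  (unit_root m ^ k)%C <> (unit_root m ^ i)%C.
Proof.
intros Hi Hk Hne H.
apply (unit_root_pow_neq_1 m (k - i)); [lia|].
assert (Hz := Cpow_nz _ i (unit_root_neq_0 m)).
replace k with (i + (k - i))%nat in H by lia.
rewrite Cpow_add_r in H.
apply (f_equal (fun z => / (unit_root m ^ i) * z)%C) in H.
rewrite Cmult_assoc, Cinv_l, Cmult_1_l in H; trivial.
Qed.

Lemma Csum_geom (q : C) d : q <> 1 -> (q ^ S d)%C = 1 -> sum_n (fun j => (q ^ j)%C) d = zero.
Proof.
intros Hq H.
assert (E : ((q - 1) * sum_n (fun j => (q ^ j)%C) d)%C = (q ^ S d - 1)%C).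
{ clear H. induction d as [|d IH].
  - rewrite sum_O. simpl. ring.
  - rewrite sum_Sn. change plus with Cplus.
    rewrite Cmult_plus_distr_l, IH, (Cpow_S q (S d)). ring. }
rewrite H in E.
assert (Hn : (q - 1)%C <> 0).
{ intro K. apply Hq. replace q with (q - 1 + 1)%C by ring. rewrite K. ring. }
apply (f_equal (fun z => / (q - 1) * z)%C) in E.
rewrite Cmult_assoc, Cinv_l, Cmult_1_l in E; trivial.
rewrite E. Cring_weak.
Qed.

(* Discrete Fourier inversion on the (d+1)-st roots of unity. *)
Lemma polyC_coeff_average c d rho i : (i <= d)%nat ->
  sum_n (fun j => polyC c d (RtoC rho * unit_root (S d) ^ j) / (unit_root (S d) ^ i) ^ j)%C d =
  (RtoC (INR (S d)) * (c i * RtoC rho ^ i))%C.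
Proof.
intros Hi. set (w := unit_root (S d)).
assert (Hw : w <> 0) by apply unit_root_neq_0.
assert (Hwm : (w ^ S d)%C = 1) by (apply unit_root_pow_m; lia).
rewrite (sum_n_ext _ (fun j => sum_n (fun k => (c k * RtoC rho ^ k) * (w ^ k / w ^ i) ^ j)%C d)).
2:{ intro j. unfold polyC, Cdiv.
  rewrite Cmult_comm. rewrite <- (sum_n_mult_l (K := C_Ring)).
  apply sum_n_ext. intro k. change mult with Cmult.
  rewrite !Cpow_mult_l, <- !Cpow_mult_r, Cpow_inv, <- !Cpow_mult_r by (now apply Cpow_nz).
  rewrite (Nat.mul_comm j k). Cring_weak. }
rewrite sum_n_switch.
set (T := fun k => sum_n (fun j => ((w ^ k / w ^ i) ^ j)%C) d).
rewrite (sum_n_ext _ (fun k => (c k * RtoC rho ^ k) * T k)%C).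
2:{ intro k. apply (sum_n_mult_l (K := C_Ring)). }
assert (Hs : forall k, (k <= d)%nat -> k <> i -> T k = zero).
{ intros k Hk Hki. apply Csum_geom.
  - intro H. assert (H' : (w ^ k)%C = (w ^ i)%C).
    { replace (w ^ k)%C with (w ^ k / w ^ i * w ^ i)%C.
      rewrite H; ring. field. now apply Cpow_nz. }
    destruct (Nat.le_ge_cases i k).
    + apply (unit_root_pow_neq (S d) i k); auto; lia.
    + apply (unit_root_pow_neq (S d) k i); auto; lia.
  - unfold Cdiv. rewrite Cpow_mult_l, Cpow_inv by (now apply Cpow_nz).
    rewrite <- !Cpow_mult_r, (Nat.mul_comm k), (Nat.mul_comm i), !Cpow_mult_r, Hwm, !Cpow_1_l.
    field. }
assert (Hd : T i = RtoC (INR (S d))).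
{ unfold T. rewrite (sum_n_ext _ (fun _ => RtoC 1)).
  2:{ intro j. replace (w ^ i / w ^ i)%C with (RtoC 1). apply Cpow_1_l.
      field. now apply Cpow_nz. }
  clear. induction d as [|d IH]. now rewrite sum_O.
  rewrite sum_Sn, IH, (S_INR (S d)), RtoC_plus. reflexivity. }
clearbody T.
rewrite <- Hd.
assert (K : forall e, (e <= d)%nat -> sum_n (fun k => (c k * RtoC rho ^ k * T k)%C) e =
  if le_dec i e then (T i * (c i * RtoC rho ^ i))%C else zero).
{ induction e as [|e IH]; intros He.
  - rewrite sum_O. destruct (le_dec i 0).
    + replace i with 0%nat by lia. Cring_weak.
    + rewrite (Hs 0%nat) by lia. Cring_weak.
  - rewrite sum_Sn, IH by lia. change plus with Cplus.
    destruct (le_dec i e), (le_dec i (S e)); try lia.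
    + rewrite (Hs (S e)) by lia. Cring_weak.
    + replace i with (S e) by lia. Cring_weak.
    + rewrite (Hs (S e)) by lia. Cring_weak. }
rewrite K by lia. destruct (le_dec i d); [reflexivity|lia].
Qed.

Lemma Cmod_sum_n_le (F : nat -> C) B d : (forall j, (j <= d)%nat -> Cmod (F j) <= B) ->
  Cmod (sum_n F d) <= INR (S d) * B.
Proof.
intros H. induction d as [|d IH].
- rewrite sum_O. simpl. rewrite Rmult_1_l. apply H; lia.
- rewrite sum_Sn, (S_INR (S d)). change plus with Cplus.
  eapply Rle_trans; [apply Cmod_triangle|].
  assert (Cmod (F (S d)) <= B) by (apply H; lia).
  assert (Cmod (sum_n F d) <= INR (S d) * B) by (apply IH; intros; apply H; lia).
  lra.
Qed.

(** There are d + 1 nodes, more than the degree, so the average over them isolates c_i rho^i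
    exactly, and an average of values of modulus at most B has modulus at most B. *)
Lemma polyC_cauchy c d rho B i : 0 <= rho -> (i <= d)%nat ->
  (forall z, Cmod z = rho -> Cmod (polyC c d z) <= B) ->
  Cmod (c i) * rho ^ i <= B.
Proof.
intros Hr Hi H.
assert (K := polyC_coeff_average c d rho i Hi).
apply (f_equal Cmod) in K.
assert (L : Cmod (sum_n (fun j => polyC c d (RtoC rho * unit_root (S d) ^ j) /
   (unit_root (S d) ^ i) ^ j)%C d) <= INR (S d) * B).
{ apply Cmod_sum_n_le. intros j Hj.
  rewrite <- Cpow_mult_r.
  rewrite Cmod_div by (apply Cpow_nz, unit_root_neq_0).
  rewrite Cmod_unit_root_pow. unfold Rdiv. rewrite Rinv_1, Rmult_1_r.
  apply H. rewrite Cmod_mult, Cmod_unit_root_pow, Cmod_R, Rabs_pos_eq; lra. }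
rewrite K, !Cmod_mult, Cmod_pow, !Cmod_R, (Rabs_pos_eq rho) in L by trivial.
assert (0 < INR (S d)) by (apply lt_0_INR; lia).
rewrite Rabs_pos_eq in L by lra.
apply Rmult_le_reg_l with (INR (S d)); assumption.
Qed.

Lemma Cpow_diff_le u u' M i : Cmod u <= M -> Cmod u' <= M ->
  Cmod (u ^ S i - u' ^ S i) <= INR (S i) * M ^ i * Cmod (u - u').
Proof.
intros Hu Hu'. induction i as [|i IH].
- simpl. rewrite !Cmult_1_r. lra.
- replace (u ^ S (S i) - u' ^ S (S i))%C with
    (u * (u ^ S i - u' ^ S i) + (u - u') * u' ^ S i)%C by (rewrite !(Cpow_S _ (S i)); ring).
  eapply Rle_trans; [apply Cmod_triangle|].
  rewrite !Cmod_mult, Cmod_pow, (S_INR (S i)).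
  assert (H0 := Cmod_ge_0 u). assert (H0' := Cmod_ge_0 u').
  assert (H1 : Cmod u' ^ S i <= M ^ S i) by (apply pow_incr; lra).
  assert (H2 := Cmod_ge_0 (u - u')).
  assert (Cmod u * Cmod (u ^ S i - u' ^ S i) <= M * (INR (S i) * M ^ i * Cmod (u - u'))).
  { apply Rmult_le_compat; trivial. apply Cmod_ge_0. }
  assert (Cmod (u - u') * Cmod u' ^ S i <= Cmod (u - u') * M ^ S i)
    by (apply Rmult_le_compat_l; trivial).
  replace ((INR (S i) + 1) * M ^ S i * Cmod (u - u')) with
    (M * (INR (S i) * M ^ i * Cmod (u - u')) + Cmod (u - u') * M ^ S i) by (simpl; ring).
  lra.
Qed.

(** The i-th term is at most (B / rho^i) i M^(i-1) |u - u'|, and M / rho <= 1/2 sums these for i >=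
    2. The remaining factor M is what makes the nonlinear part small after rescaling. The degree is
    written [S d] so that the linear coefficient is present. *)
Lemma polyC_second_order c d rho B M : 0 < rho -> 0 <= B ->
  (forall i, (i <= S d)%nat -> Cmod (c i) * rho ^ i <= B) -> M <= rho / 2 ->
  forall u u', Cmod u <= M -> Cmod u' <= M ->
  Cmod (polyC c (S d) u - polyC c (S d) u' - c 1%nat * (u - u')) <=
    6 * B / rho ^ 2 * M * Cmod (u - u').
Proof.
intros Hr HB Hc HM u u' Hu Hu'.
assert (HM0 : 0 <= M) by (eapply Rle_trans; [apply Cmod_ge_0|exact Hu]).
assert (HD := Cmod_ge_0 (u - u')).
set (K := B / rho ^ 2 * M * Cmod (u - u')).
assert (Hr2 : 0 < rho ^ 2) by (apply pow_lt; lra).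
assert (HK : 0 <= K).
{ unfold K. repeat apply Rmult_le_pos; trivial. now apply Rlt_le, Rinv_0_lt_compat. }
(* the partial sums of [sum_(i >= 2) i / 2^(i-2) = 6] *)
assert (Hind : forall e, (e <= d)%nat ->
  Cmod (polyC c (S e) u - polyC c (S e) u' - c 1%nat * (u - u')) <=
    K * (6 - (INR e + 3) * 2 / 2 ^ e)).
{ induction e as [|e IH]; intros He.
  - rewrite !polyC_S, !polyC_0. simpl.
    match goal with |- Cmod ?z <= _ => replace z with (RtoC 0) by ring end.
    rewrite Cmod_0. apply Rle_trans with (K * 0); [lra|].
    apply Rmult_le_compat_l; lra.
  - rewrite !(polyC_S c (S e)).
    match goal with |- Cmod ?z <= _ => replace z with
      ((polyC c (S e) u - polyC c (S e) u' - c 1%nat * (u - u')) +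
       c (S (S e)) * (u ^ S (S e) - u' ^ S (S e)))%C by ring end.
    eapply Rle_trans; [apply Cmod_triangle|].
    specialize (IH ltac:(lia)).
    assert (H1 : Cmod (c (S (S e)) * (u ^ S (S e) - u' ^ S (S e))) <=
       K * ((INR e + 2) / 2 ^ e)).
    { rewrite Cmod_mult.
      assert (HP := Cpow_diff_le u u' M (S e) Hu Hu').
      assert (Hcc := Hc (S (S e)) ltac:(lia)).
      assert (Hrp : 0 < rho ^ S (S e)) by (apply pow_lt; lra).
      assert (Hcb : Cmod (c (S (S e))) <= B / rho ^ S (S e)).
      { apply Rmult_le_reg_r with (rho ^ S (S e)); trivial.
        unfold Rdiv. rewrite Rmult_assoc, Rinv_l; lra. }
      eapply Rle_trans.
      { apply Rmult_le_compat; [apply Cmod_ge_0|apply Cmod_ge_0|exact Hcb|exact HP]. }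
      assert (Hpow : M ^ e <= (rho / 2) ^ e) by (apply pow_incr; lra).
      assert (Hq : M ^ e / rho ^ e <= / 2 ^ e).
      { unfold Rdiv in Hpow. rewrite Rpow_mult_distr, pow_inv in Hpow.
        assert (0 < rho ^ e) by (apply pow_lt; lra).
        apply Rmult_le_reg_r with (rho ^ e); trivial.
        unfold Rdiv. rewrite Rmult_assoc, Rinv_l; lra. }
      assert (Hre : 0 < rho ^ e) by (apply pow_lt; lra).
      assert (H2e : 0 < 2 ^ e) by (apply pow_lt; lra).
      replace (B / rho ^ S (S e) * (INR (S (S e)) * M ^ S e * Cmod (u - u')))
        with (K * (INR e + 2) * (M ^ e / rho ^ e)).
      2:{ unfold K. rewrite !S_INR. simpl. field. lra. }
      replace (K * ((INR e + 2) / 2 ^ e)) with (K * (INR e + 2) * / 2 ^ e) by (unfold Rdiv; ring).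
      apply Rmult_le_compat_l; trivial.
      apply Rmult_le_pos; trivial. assert (0 <= INR e) by apply pos_INR. lra. }
    replace (K * (6 - (INR (S e) + 3) * 2 / 2 ^ S e)) with
      (K * (6 - (INR e + 3) * 2 / 2 ^ e) + K * ((INR e + 2) / 2 ^ e)).
    lra.
    rewrite S_INR. simpl. field. apply pow_nonzero; lra. }
eapply Rle_trans; [apply Hind; lia|].
replace (6 * B / rho ^ 2 * M * Cmod (u - u')) with (K * 6) by (unfold K, Rdiv; ring).
apply Rmult_le_compat_l; trivial.
assert (0 <= (INR d + 3) * 2 / 2 ^ d); [|lra].
assert (0 <= INR d) by apply pos_INR.
apply Rdiv_le_0_compat. lra. apply pow_lt; lra.
Qed.

(** * Passage from Taylor polynomials to the entire function *)

Lemma pow_n_Cpow (z : C) k : @pow_n C_AbsRing z k = (z ^ k)%C.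
Proof. induction k as [|k IH]; simpl; [reflexivity|]. now rewrite IH. Qed.

Definition taylor (f : C -> C) (a : nat -> C) : Prop :=
  forall z eps, 0 < eps -> exists N, forall n, (N <= n)%nat -> Cmod (polyC a n z - f z) <= eps.

Lemma is_pseries_taylor f a :
  (forall z : C, @is_pseries C_AbsRing C_NormedModule a z (f z)) -> taylor f a.
Proof.
intros H z eps He. specialize (H z). unfold is_pseries, is_series in H.
assert (H' := proj1 (filterlim_locally_ball_norm (K := C_AbsRing) (U := C_NormedModule) _ _) H (mkposreal eps He)).
destruct H' as [N HN]. exists N. intros n Hn. specialize (HN n Hn).
unfold ball_norm in HN.
apply Rlt_le. eapply Rle_lt_trans; [|exact HN]. apply Req_le.
apply (f_equal (fun s => Cmod (s - f z)%C)).
unfold polyC. apply sum_n_ext. intro k.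
rewrite <- pow_n_Cpow. apply Cmult_comm.
Qed.

Lemma finite_bound (w : nat -> R) m : exists A, 0 <= A /\ forall k, (k < m)%nat -> w k <= A.
Proof.
induction m as [|m [A [HA IH]]].
- exists 0. split; [lra|]. intros; lia.
- exists (Rmax A (w m)). split.
  + eapply Rle_trans; [exact HA|apply Rmax_l].
  + intros k Hk. destruct (Nat.eq_dec k m) as [->|].
    * apply Rmax_r.
    * eapply Rle_trans; [apply IH; lia|apply Rmax_l].
Qed.

Lemma taylor_bound f a rho : taylor f a -> 0 < rho ->
  exists A, 0 <= A /\ forall k, Cmod (a k) * rho ^ k <= A.
Proof.
intros H Hr.
destruct (H (RtoC rho) 1 ltac:(lra)) as [N HN].
assert (HS : forall k, (S N <= k)%nat -> Cmod (a k) * rho ^ k <= 2).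
{ intros [|k] Hk; [lia|].
  assert (H1 := HN k ltac:(lia)). assert (H2 := HN (S k) ltac:(lia)).
  rewrite polyC_S in H2.
  replace (Cmod (a (S k)) * rho ^ S k) with (Cmod (a (S k) * RtoC rho ^ S k)).
  2:{ rewrite Cmod_mult, Cmod_pow, Cmod_R, Rabs_pos_eq; lra. }
  replace (a (S k) * RtoC rho ^ S k)%C with
    ((polyC a k rho + a (S k) * RtoC rho ^ S k - f rho) + - (polyC a k rho - f rho))%C by ring.
  eapply Rle_trans; [apply Cmod_triangle|]. rewrite Cmod_opp. lra. }
destruct (finite_bound (fun k => Cmod (a k) * rho ^ k) (S N)) as [A [HA HA']].
exists (Rmax A 2). split.
- eapply Rle_trans; [exact HA|apply Rmax_l].
- intros k. destruct (le_lt_dec (S N) k).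
  + eapply Rle_trans; [apply HS; lia|apply Rmax_r].
  + eapply Rle_trans; [apply HA'; lia|apply Rmax_l].
Qed.

Lemma pow_half_small eps : 0 < eps -> exists N, forall n, (N <= n)%nat -> (1 / 2) ^ n <= eps.
Proof.
intros He.
destruct (pow_lt_1_zero (1/2) ltac:(rewrite Rabs_pos_eq; lra) eps He) as [N HN].
exists N. intros n Hn. specialize (HN n Hn).
assert (0 < (1/2) ^ n) by (apply pow_lt; lra).
rewrite Rabs_pos_eq in HN; lra.
Qed.

(** Boundedness of the terms at radius 2 rho makes them decay like 2^(-k) on |z| <= rho, which
    bounds the tails uniformly. *)
Lemma taylor_unif f a rho eps : taylor f a -> 0 < rho -> 0 < eps ->
  exists N, forall n z, (N <= n)%nat -> Cmod z <= rho -> Cmod (polyC a n z - f z) <= eps.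
Proof.
intros H Hr He.
destruct (taylor_bound f a (2 * rho) H ltac:(lra)) as [A [HA Hb]].
destruct (pow_half_small (eps / (A + 1))) as [N HN].
{ apply Rdiv_lt_0_compat; lra. }
exists N. intros n z Hn Hz.
assert (Hterm : forall k, Cmod (a k * z ^ k) <= A * (1/2) ^ k).
{ intro k. rewrite Cmod_mult, Cmod_pow.
  assert (Cmod z ^ k <= rho ^ k) by (apply pow_incr; split; [apply Cmod_ge_0|trivial]).
  assert (Cmod (a k) * Cmod z ^ k <= Cmod (a k) * rho ^ k)
    by (apply Rmult_le_compat_l; trivial; apply Cmod_ge_0).
  specialize (Hb k). rewrite Rpow_mult_distr in Hb.
  assert (0 < 2 ^ k) by (apply pow_lt; lra).
  replace ((1/2) ^ k) with (/ 2 ^ k) by (unfold Rdiv; rewrite Rmult_1_l, pow_inv; trivial).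
  apply Rmult_le_reg_r with (2 ^ k); trivial.
  rewrite (Rmult_assoc A), Rinv_l by lra. nra. }
assert (Htail : forall j, Cmod (polyC a (n + j) z - polyC a n z) <= A * (1/2) ^ n * (1 - (1/2) ^ j)).
{ induction j as [|j IH].
  - rewrite Nat.add_0_r. replace (polyC a n z - polyC a n z)%C with (RtoC 0) by ring.
    rewrite Cmod_0. simpl. lra.
  - rewrite Nat.add_succ_r, polyC_S.
    replace (polyC a (n + j) z + a (S (n + j)) * z ^ S (n + j) - polyC a n z)%C
      with ((polyC a (n + j) z - polyC a n z) + a (S (n + j)) * z ^ S (n + j))%C by ring.
    eapply Rle_trans; [apply Cmod_triangle|].
    assert (Ht := Hterm (S (n + j))).
    replace ((1/2) ^ S (n + j)) with ((1/2) ^ n * (1/2) ^ j * (1/2)) in Ht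
      by (simpl; rewrite pow_add; ring).
    simpl ((1/2) ^ S j). nra. }
assert (Hn2 := HN n Hn).
assert (Hp : 0 < (1/2) ^ n) by (apply pow_lt; lra).
(* The tail bound concerns differences of partial sums; pointwise convergence at z, up to eta,
   transfers it to f z. *)
apply le_epsilon. intros eta Heta.
destruct (H z (eta) Heta) as [N2 HN2].
specialize (HN2 (n + N2)%nat ltac:(lia)).
replace (polyC a n z - f z)%C with
  ((polyC a (n + N2) z - f z) + - (polyC a (n + N2) z - polyC a n z))%C by ring.
eapply Rle_trans; [apply Cmod_triangle|]. rewrite Cmod_opp.
specialize (Htail N2).
assert (0 < (1/2) ^ N2) by (apply pow_lt; lra).
assert (A * (1/2) ^ n <= eps).
{ apply Rle_trans with ((A + 1) * (1/2)^n); [nra|].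
  apply Rmult_le_compat_l with (r := A + 1) in Hn2; [|lra].
  replace ((A + 1) * (eps / (A + 1))) with eps in Hn2 by (field; lra). exact Hn2. }
assert (0 <= A * (1/2) ^ n) by nra.
nra.
Qed.

(** The polynomial estimate is applied to a Taylor polynomial close to f, recentred at x. Its linear
    coefficient is not l, so the two are first compared by means of a small increment h; all errors
    are O(eta) and eta then tends to 0. *)
Lemma taylor_second_order f a x l rho B M : taylor f a -> cderiv f x l -> 0 < rho ->
  (forall z, Cmod (z - x) = rho -> Cmod (f z) <= B) -> M <= rho / 2 ->
  forall u u', Cmod u <= M -> Cmod u' <= M ->
  Cmod (f (x + u)%C - f (x + u')%C - l * (u - u')) <= 6 * B / rho ^ 2 * M * Cmod (u - u').
Proof.
intros Ht Hd Hr HB HM u u' Hu Hu'.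
assert (HB0 : 0 <= B).
{ eapply Rle_trans; [apply Cmod_ge_0|apply (HB (x + RtoC rho)%C)].
  replace (x + RtoC rho - x)%C with (RtoC rho) by ring.
  rewrite Cmod_R, Rabs_pos_eq; lra. }
assert (HM0 : 0 <= M) by (eapply Rle_trans; [apply Cmod_ge_0|exact Hu]).
assert (HD := Cmod_ge_0 (u - u')).
assert (Hr2 : 0 < rho ^ 2) by (apply pow_lt; lra).
assert (Hir2 : 0 < / rho ^ 2) by (apply Rinv_0_lt_compat; lra).
set (D := Cmod (u - u')) in *.
assert (Happ : forall eta, 0 < eta <= 1 ->
  Cmod (f (x + u)%C - f (x + u')%C - l * (u - u')) <=
  6 * B / rho ^ 2 * M * D + eta * (6 / rho ^ 2 * M * D + 2 + 4 * D)).
{ intros eta [He He1].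
  set (K := 6 * (B + 1) / rho ^ 2 * 1).
  assert (HK : 0 < K) by (unfold K, Rdiv; nra).
  destruct (Hd eta He) as [d0 [Hd0 Hder]].
  (* The three bounds serve in turn the differentiability of f at x, the range of the polynomial
     estimate, and the reduction of the quadratic term to at most eta h. *)
  set (h := Rmin (d0 / 2) (Rmin (rho / 2) (eta / K))).
  assert (Hek : 0 < eta / K) by (apply Rdiv_lt_0_compat; lra).
  assert (Hh : 0 < h) by (unfold h; repeat apply Rmin_glb_lt; lra).
  assert (Hh1 : h <= d0 / 2) by apply Rmin_l.
  assert (Hh2 : h <= rho / 2) by (eapply Rle_trans; [apply Rmin_r|apply Rmin_l]).
  assert (Hh3 : h <= eta / K) by (eapply Rle_trans; [apply Rmin_r|apply Rmin_r]).
  (* The approximation error has to be O(eta h), because the comparison of linear coefficients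
     divides it by h. *)
  set (e2 := Rmin (eta * h) eta).
  assert (He2 : 0 < e2) by (unfold e2; apply Rmin_glb_lt; nra).
  destruct (taylor_unif f a (Cmod x + rho) e2 Ht) as [N HN]; trivial.
  { assert (Hx := Cmod_ge_0 x). lra. }
  assert (Happ : forall v, Cmod v <= rho -> Cmod (polyC a (S N) (x + v) - f (x + v)%C) <= e2).
  { intros v Hv. apply HN; [lia|]. eapply Rle_trans; [apply Cmod_triangle|]. lra. }
  destruct (polyC_shift a (S N) x) as [c Hc].
  assert (Hcb : forall i, (i <= S N)%nat -> Cmod (c i) * rho ^ i <= B + eta).
  { intros i Hi. apply (polyC_cauchy c (S N) rho); trivial; [lra|].
    intros z Hz. rewrite <- Hc.
    replace (polyC a (S N) (x + z)) with ((polyC a (S N) (x + z) - f (x + z)%C) + f (x + z)%C)%C by ring.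
    eapply Rle_trans; [apply Cmod_triangle|].
    assert (H1 := Happ z ltac:(lra)).
    assert (H2 : Cmod (f (x + z)%C) <= B).
    { apply HB. replace (x + z - x)%C with z by ring. trivial. }
    assert (e2 <= eta) by apply Rmin_r. lra. }
  assert (Hso := fun M' H => polyC_second_order c N rho (B + eta) M' Hr ltac:(lra) Hcb H).
  (* Four errors of size eta h: the quadratic remainder, the derivative of f, and the approximation
     of f at x + h and at x. *)
  assert (Hl : Cmod (l - c 1%nat) <= 4 * eta).
  { assert (Hhm : Cmod (RtoC h) = h) by (rewrite Cmod_R, Rabs_pos_eq; lra).
    assert (H1 := Hso h Hh2 (RtoC h) 0 ltac:(lra) ltac:(rewrite Cmod_0; lra)).
    rewrite <- !Hc, !Cplus_0_r in H1.
    assert (H2 := Hder (RtoC h) ltac:(rewrite Hhm; lra)). rewrite Hhm in H2.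
    assert (H3 := Happ (RtoC h) ltac:(rewrite Hhm; lra)).
    assert (H4 := Happ 0 ltac:(rewrite Cmod_0; lra)). rewrite Cplus_0_r in H4.
    assert (He2h : e2 <= eta * h) by apply Rmin_l.
    replace (RtoC h - 0)%C with (RtoC h) in H1 by ring. rewrite Hhm in H1.
    assert (H5 : 6 * (B + eta) / rho ^ 2 * h * h <= eta * h).
    { apply Rmult_le_compat_r; [lra|].
      apply Rle_trans with (K * h).
      - apply Rmult_le_compat_r; [lra|]. unfold K, Rdiv. nra.
      - apply Rmult_le_compat_l with (r := K) in Hh3; [|lra].
        replace (K * (eta / K)) with eta in Hh3 by (field; lra). exact Hh3. }
    apply Rmult_le_reg_r with h; trivial.
    rewrite <- Hhm at 1. rewrite <- Cmod_mult.
    replace ((l - c 1%nat) * RtoC h)%C with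
      ((polyC a (S N) (x + h) - polyC a (S N) x - c 1%nat * h)
       + (- (f (x + h)%C - f x - l * h)
       + ((polyC a (S N) x - f x) + - (polyC a (S N) (x + h) - f (x + h)%C))))%C by ring.
    eapply Rle_trans; [apply Cmod_triangle|].
    eapply Rle_trans; [apply Rplus_le_compat_l, Cmod_triangle|].
    eapply Rle_trans; [apply Rplus_le_compat_l, Rplus_le_compat_l, Cmod_triangle|].
    rewrite !Cmod_opp. lra. }
  assert (H1 := Hso M HM u u' Hu Hu'). rewrite <- !Hc in H1. fold D in H1.
  assert (H3 := Happ u ltac:(lra)). assert (H4 := Happ u' ltac:(lra)).
  assert (He2' : e2 <= eta) by apply Rmin_r.
  replace (f (x + u)%C - f (x + u')%C - l * (u - u'))%C with
    ((polyC a (S N) (x + u) - polyC a (S N) (x + u') - c 1%nat * (u - u'))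
     + ((polyC a (S N) (x + u') - f (x + u')%C)
     + (- (polyC a (S N) (x + u) - f (x + u)%C) + - ((l - c 1%nat) * (u - u')))))%C by ring.
  eapply Rle_trans; [apply Cmod_triangle|].
  eapply Rle_trans; [apply Rplus_le_compat_l, Cmod_triangle|].
  eapply Rle_trans; [apply Rplus_le_compat_l, Rplus_le_compat_l, Cmod_triangle|].
  rewrite !Cmod_opp, Cmod_mult. fold D.
  assert (Cmod (l - c 1%nat) * D <= 4 * eta * D) by (apply Rmult_le_compat_r; trivial).
  replace (6 * B / rho ^ 2 * M * D + eta * (6 / rho ^ 2 * M * D + 2 + 4 * D)) with
    (6 * (B + eta) / rho ^ 2 * M * D + 2 * eta + 4 * eta * D) by (unfold Rdiv; ring).
  lra. }
apply le_epsilon. intros eps Heps.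
set (Q := 6 / rho ^ 2 * M * D + 2 + 4 * D) in *.
assert (HQ : 0 < Q).
{ unfold Q. assert (0 <= 6 / rho ^ 2 * M * D); [|lra].
  repeat apply Rmult_le_pos; lra. }
specialize (Happ (Rmin 1 (eps / Q))).
assert (HeQ : 0 < eps / Q) by (apply Rdiv_lt_0_compat; lra).
eapply Rle_trans; [apply Happ; split; [apply Rmin_glb_lt; lra|apply Rmin_l]|].
apply Rplus_le_compat_l.
apply Rle_trans with (eps / Q * Q).
- apply Rmult_le_compat_r; [lra|apply Rmin_r].
- apply Req_le. field. lra.
Qed.

(** * Backward recursions close to the identity *)

Definition Ctends (Y : nat -> C) (t : C) : Prop :=
  forall eps, 0 < eps -> exists N, forall n, (N <= n)%nat -> Cmod (Y n - t) <= eps.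

Lemma Cmod_minus_sym (a b : C) : Cmod (a - b) = Cmod (b - a).
Proof. rewrite <- Cmod_opp. f_equal. ring. Qed.

Lemma Cmod_triangle3 (a b c : C) : Cmod (a - c) <= Cmod (a - b) + Cmod (b - c).
Proof. replace (a - c)%C with ((a - b) + (b - c))%C by ring. apply Cmod_triangle. Qed.

Lemma Cmod_le_eps_eq (a b : C) : (forall eps, 0 < eps -> Cmod (a - b) <= eps) -> a = b.
Proof.
intros H. assert (Cmod (a - b) = 0).
{ apply Rle_antisym; [|apply Cmod_ge_0]. apply le_epsilon. intros eps He.
  rewrite Rplus_0_l. now apply H. }
apply Cmod_eq_0 in H0. replace a with (a - b + b)%C by ring. rewrite H0. ring.
Qed.

Lemma Ctends_unique Y a b : Ctends Y a -> Ctends Y b -> a = b.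
Proof.
intros Ha Hb. apply Cmod_le_eps_eq. intros eps He.
destruct (Ha (eps/2)) as [N1 H1]; [lra|]. destruct (Hb (eps/2)) as [N2 H2]; [lra|].
specialize (H1 (N1 + N2)%nat ltac:(lia)). specialize (H2 (N1 + N2)%nat ltac:(lia)).
eapply Rle_trans; [apply (Cmod_triangle3 a (Y (N1 + N2)%nat) b)|].
rewrite Cmod_minus_sym. lra.
Qed.

Lemma Ctends_le Y a r : Ctends Y a -> (exists N, forall n, (N <= n)%nat -> Cmod (Y n) <= r) -> Cmod a <= r.
Proof.
intros Ha [N HN]. apply le_epsilon. intros eps He.
destruct (Ha eps He) as [N1 H1].
specialize (H1 (N1 + N)%nat ltac:(lia)). specialize (HN (N1 + N)%nat ltac:(lia)).
replace a with (Y (N1 + N)%nat + - (Y (N1 + N)%nat - a))%C by ring.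
eapply Rle_trans; [apply Cmod_triangle|]. rewrite Cmod_opp. lra.
Qed.

Lemma geometric_Cauchy_R (u : nat -> R) c :
  (forall k, Rabs (u (S k) - u k) <= c * (1/2) ^ k) -> exists l, is_lim_seq u (Finite l).
Proof.
intros H.
assert (Hc : 0 <= c).
{ specialize (H 0%nat). simpl in H. assert (H1 := Rabs_pos (u 1%nat - u 0%nat)). lra. }
assert (Ht : forall k j, Rabs (u (k + j)%nat - u k) <= 2 * c * (1/2) ^ k * (1 - (1/2) ^ j)).
{ intros k j. induction j as [|j IH].
  - rewrite Nat.add_0_r, Rminus_diag, Rabs_R0. simpl. lra.
  - rewrite Nat.add_succ_r.
    replace (u (S (k + j)) - u k) with ((u (S (k + j)) - u (k + j)%nat) + (u (k + j)%nat - u k)) by ring.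
    eapply Rle_trans; [apply Rabs_triang|].
    specialize (H (k + j)%nat). rewrite pow_add in H. simpl. lra. }
assert (HC : ex_finite_lim_seq u).
{ apply ex_lim_seq_cauchy_corr. intros eps. destruct (pow_half_small (eps / (2 * (2 * c + 1)))) as [N HN].
  { apply Rdiv_lt_0_compat; [apply cond_pos|lra]. }
  assert (HN' := HN N (le_n N)).
  assert (He := cond_pos eps).
  assert (Hq : 0 < (1/2) ^ N) by (apply pow_lt; lra).
  assert (Hs : 2 * c * (1/2) ^ N < eps / 2).
  { apply Rmult_le_compat_l with (r := 2 * c + 1) in HN'; [|lra].
    replace ((2 * c + 1) * (eps / (2 * (2 * c + 1)))) with (eps / 2) in HN' by (field; lra). nra. }
  assert (HA : forall n, (N <= n)%nat -> Rabs (u n - u N) <= 2 * c * (1/2) ^ N).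
  { intros n Hn. replace n with (N + (n - N))%nat by lia.
    eapply Rle_trans; [apply Ht|].
    assert (0 < (1/2) ^ (n - N)) by (apply pow_lt; lra).
    assert (0 <= 2 * c * (1/2) ^ N) by nra. nra. }
  exists N. intros n p Hn Hp.
  replace (u n - u p) with ((u n - u N) + - (u p - u N)) by ring.
  eapply Rle_lt_trans; [apply Rabs_triang|]. rewrite Rabs_Ropp.
  assert (H1 := HA n Hn). assert (H2 := HA p Hp). lra. }
exact HC.
Qed.

Lemma geometric_Cauchy (s : nat -> C) c :
  (forall k, Cmod (s (S k) - s k) <= c * (1/2) ^ k) ->
  exists l, Ctends s l /\ forall k, Cmod (s k - l) <= 2 * c * (1/2) ^ k.
Proof.
intros H.
assert (Hc : 0 <= c).
{ specialize (H 0%nat). simpl in H. assert (H1 := Cmod_ge_0 (s 1%nat - s 0%nat)). lra. }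
assert (HR : forall z : C, Rabs (fst z) <= Cmod z /\ Rabs (snd z) <= Cmod z).
{ intro z. split; eapply Rle_trans; try apply Rmax_Cmod; [apply Rmax_l|apply Rmax_r]. }
destruct (geometric_Cauchy_R (fun k => fst (s k)) c) as [l1 H1].
{ intro k. eapply Rle_trans; [|apply H]. apply (HR (s (S k) - s k)%C). }
destruct (geometric_Cauchy_R (fun k => snd (s k)) c) as [l2 H2].
{ intro k. eapply Rle_trans; [|apply H]. apply (HR (s (S k) - s k)%C). }
assert (HT : Ctends s (l1, l2)).
{ intros eps He.
  apply is_lim_seq_spec in H1. apply is_lim_seq_spec in H2.
  destruct (H1 (mkposreal (eps/2) ltac:(lra))) as [N1 K1].
  destruct (H2 (mkposreal (eps/2) ltac:(lra))) as [N2 K2].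
  exists (N1 + N2)%nat. intros n Hn.
  specialize (K1 n ltac:(lia)). specialize (K2 n ltac:(lia)). simpl in K1, K2.
  eapply Rle_trans; [apply Cmod_2Rmax|].
  simpl. change (fst (s n) + - l1) with (fst (s n) - l1). change (snd (s n) + - l2) with (snd (s n) - l2).
  assert (Hm : Rmax (Rabs (fst (s n) - l1)) (Rabs (snd (s n) - l2)) <= eps / 2).
  { apply Rmax_lub; lra. }
  assert (Hm0 : 0 <= Rmax (Rabs (fst (s n) - l1)) (Rabs (snd (s n) - l2))).
  { eapply Rle_trans; [apply Rabs_pos|apply Rmax_l]. }
  assert (sqrt 2 <= 2).
  { rewrite <- (sqrt_Rsqr 2) at 2 by lra. apply sqrt_le_1_alt. unfold Rsqr. lra. }
  assert (0 <= sqrt 2) by apply sqrt_pos. nra. }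
exists (l1, l2). split; [exact HT|].
assert (Ht : forall k j, Cmod (s (k + j)%nat - s k) <= 2 * c * (1/2) ^ k * (1 - (1/2) ^ j)).
{ intros k j. induction j as [|j IH].
  - rewrite Nat.add_0_r. replace (s k - s k)%C with (RtoC 0) by ring. rewrite Cmod_0. simpl. lra.
  - rewrite Nat.add_succ_r.
    eapply Rle_trans; [apply (Cmod_triangle3 _ (s (k + j)%nat))|].
    specialize (H (k + j)%nat). rewrite pow_add in H. simpl. lra. }
intros k. apply le_epsilon. intros eps He.
destruct (HT eps He) as [N HN]. specialize (HN (k + N)%nat ltac:(lia)).
eapply Rle_trans; [apply (Cmod_triangle3 _ (s (k + N)%nat))|].
rewrite Cmod_minus_sym. specialize (Ht k N).
assert (0 < (1/2) ^ N) by (apply pow_lt; lra).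
assert (0 < (1/2) ^ k) by (apply pow_lt; lra).
assert (0 <= 2 * c * (1/2) ^ k) by nra. nra.
Qed.

Lemma half_pow_bounds n : 0 < (1/2) ^ n <= 1.
Proof.
split; [apply pow_lt; lra|]. apply Rle_trans with (1 ^ n); [apply pow_incr; lra|rewrite pow1; lra].
Qed.

(** Downward induction on the sharper claim E_n <= B (1 + 2^(-n)). With q = 2^(-n), one step turns B
    (1 + q/2) into at most B (1 + q/2) + (q/16) 4B + (q/4) B = B (1 + q), which is where 1/16 and
    1/4 come from. The step may assume the a priori bound 2B, as the estimates on G_n hold only on a
    ball. *)
Lemma backward_bound (E : nat -> R) B m N : 0 <= B -> (m <= N)%nat ->
  E N <= B -> E (S N) <= B ->
  (forall n, (m <= n < N)%nat -> E (S n) <= 2 * B -> E (S (S n)) <= 2 * B ->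
    E n <= E (S n) + (1/2) ^ n / 16 * (E (S n) + E (S (S n))) + (1/2) ^ n / 4 * B) ->
  forall n, (m <= n <= S N)%nat -> E n <= 2 * B.
Proof.
intros HB Hm HN HSN H.
assert (K : forall k n, (n + k = N)%nat -> (m <= n)%nat ->
  E n <= B * (1 + (1/2) ^ n) /\ E (S n) <= B * (1 + (1/2) ^ (S n))).
{ induction k as [|k IH]; intros n Hn Hmn.
  - replace n with N by lia.
    assert (H1 := half_pow_bounds N). assert (H2 := half_pow_bounds (S N)). split; nra.
  - destruct (IH (S n) ltac:(lia) ltac:(lia)) as [H1 H2]. split; [|exact H1].
    assert (Hq := half_pow_bounds n).
    simpl in H1, H2. set (q := (1/2) ^ n) in *.
    assert (HBq : 0 <= B * q <= B) by (split; nra).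
    assert (Ha : E (S n) <= 2 * B) by lra. assert (Hb : E (S (S n)) <= 2 * B) by lra.
    specialize (H n ltac:(lia) Ha Hb). fold q in H.
    assert (q * (E (S n) + E (S (S n))) <= q * (4 * B)) by (apply Rmult_le_compat_l; lra).
    lra. }
intros n Hn. destruct (Nat.eq_dec n (S N)) as [->|].
- lra.
- destruct (K (N - n)%nat n ltac:(lia) ltac:(lia)) as [H1 _].
  assert (Hq := half_pow_bounds n). nra.
Qed.

Definition solves (G : nat -> C -> C) (kap Y : nat -> C) : Prop :=
  forall n, Y n = (G n (Y (S n)) - kap n * Y (S (S n)))%C.

(** The radius [T] and the starting index [m] are traded against each other: in the application
    every radius is admissible from some index on. *)
Definition near_identity (G : nat -> C -> C) (kap : nat -> C) (T : R) (m : nat) : Prop :=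
  forall n, (m <= n)%nat -> Cmod (kap n) <= (1/2) ^ n / 16 /\
    forall y y', Cmod y <= T -> Cmod y' <= T ->
      Cmod (G n y - G n y' - (y - y')) <= (1/2) ^ n / 16 * Cmod (y - y').

Definition continuousC (g : C -> C) : Prop :=
  forall y eps, 0 < eps -> exists d, 0 < d /\
    forall y', Cmod (y' - y) <= d -> Cmod (g y' - g y) <= eps.

(** The recursion has order two, so the pair (Y_n, Y_(n+1)) is carried, with k the distance from n
    to the end. *)
Fixpoint back (G : nat -> C -> C) (kap : nat -> C) (t : C) (k n : nat) : C * C :=
  match k with
  | 0 => (t, t)
  | S k => let p := back G kap t k (S n) in ((G n (fst p) - kap n * snd p)%C, fst p)
  end.

(* The solution on [0..N] with end values [Y_N = Y_(N+1) = t]. *)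
Definition truncated G kap t N n := fst (back G kap t (N - n) n).

Lemma truncated_end G kap t N : truncated G kap t N N = t /\ truncated G kap t N (S N) = t.
Proof.
(* Truncated subtraction makes the distance 0 past N as well, so the value at N + 1 is also t. *)
unfold truncated. rewrite Nat.sub_diag. replace (N - S N)%nat with 0%nat by lia. now split.
Qed.

Lemma truncated_step G kap t N n : (n < N)%nat ->
  truncated G kap t N n =
  (G n (truncated G kap t N (S n)) - kap n * truncated G kap t N (S (S n)))%C.
Proof.
intros Hn. unfold truncated. replace (N - n)%nat with (S (N - S n)) by lia. simpl.
do 2 f_equal.
destruct (N - S n)%nat eqn:E.
- replace (N - S (S n))%nat with 0%nat by lia. reflexivity.
- replace (N - S (S n))%nat with n0 by lia. reflexivity.
Qed.

Lemma near_identity_step G kap T m n a b a' b' : near_identity G kap T m -> (m <= n)%nat ->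
  Cmod a <= T -> Cmod a' <= T ->
  Cmod ((G n a - kap n * b) - (G n a' - kap n * b')) <=
  Cmod (a - a') + (1/2) ^ n / 16 * (Cmod (a - a') + Cmod (b - b')).
Proof.
intros H Hn Ha Ha'. destruct (H n Hn) as [Hk HG]. specialize (HG a a' Ha Ha').
replace ((G n a - kap n * b) - (G n a' - kap n * b'))%C with
  ((a - a') + ((G n a - G n a' - (a - a')) + - (kap n * (b - b'))))%C by ring.
eapply Rle_trans; [apply Cmod_triangle|].
eapply Rle_trans; [apply Rplus_le_compat_l, Cmod_triangle|].
rewrite Cmod_opp, Cmod_mult. assert (H1 := Cmod_ge_0 (b - b')). nra.
Qed.

(** Comparison with the zero solution, available because G_n(0) = 0. *)
Lemma truncated_bound G kap t T N m : (forall n, G n (RtoC 0) = RtoC 0) -> near_identity G kap (2 * T) m ->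
  Cmod t <= T -> (m <= N)%nat ->
  forall n, (m <= n <= S N)%nat -> Cmod (truncated G kap t N n) <= 2 * T.
Proof.
intros HG0 HG Ht Hm. destruct (truncated_end G kap t N) as [E1 E2].
assert (HT : 0 <= T) by (eapply Rle_trans; [apply Cmod_ge_0|exact Ht]).
apply backward_bound; trivial; [now rewrite E1|now rewrite E2|].
intros n Hn H1 H2. rewrite truncated_step by lia.
assert (H := near_identity_step G kap (2 * T) m n (truncated G kap t N (S n))
  (truncated G kap t N (S (S n))) 0 0 HG ltac:(lia) H1 ltac:(rewrite Cmod_0; lra)).
rewrite HG0 in H.
match type of H with Cmod ?z <= _ => replace z with
  (G n (truncated G kap t N (S n)) - kap n * truncated G kap t N (S (S n)))%C in H by ring end.
unfold Cminus in H. rewrite Copp_0, !Cplus_0_r in H. fold (Cminus (G n (truncated G kap t N (S n))) (kap n * truncated G kap t N (S (S n)))%C) in H.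
assert (Hq := half_pow_bounds n). nra.
Qed.

(** At index N the truncation at N + 1 has the value G_N(t) - kap_N t instead of t, a difference of
    at most T 2^(-N) / 4. [backward_bound] carries it down to n at the cost of a factor 2, so the
    truncations form a geometric Cauchy sequence in N. Summing from N = n, where the value is t,
    gives the distance to t. *)
Lemma truncated_limit G kap t T m : (forall n, G n (RtoC 0) = RtoC 0) -> near_identity G kap (2 * T) m ->
  Cmod t <= T -> forall n, (m <= n)%nat ->
  exists l, Ctends (fun N => truncated G kap t N n) l /\ Cmod (t - l) <= T * (1/2) ^ n.
Proof.
intros HG0 HG Ht n Hn.
assert (HT : 0 <= T) by (eapply Rle_trans; [apply Cmod_ge_0|exact Ht]).
assert (HD : forall N, (m <= N)%nat -> forall n, (m <= n <= S N)%nat ->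
  Cmod (truncated G kap t N n - truncated G kap t (S N) n) <= 2 * (T * (1/2) ^ N / 4)).
{ intros N HN. assert (HqN := half_pow_bounds N).
  destruct (truncated_end G kap t N) as [E1 E2].
  destruct (truncated_end G kap t (S N)) as [E3 E4].
  apply backward_bound; trivial.
  - nra.
  - rewrite E1, truncated_step, E3, E4 by lia.
    destruct (HG N HN) as [Hk HGN].
    specialize (HGN t 0 ltac:(lra) ltac:(rewrite Cmod_0; lra)). rewrite HG0 in HGN.
    replace (t - 0)%C with t in HGN by ring.
    replace (t - (G N t - kap N * t))%C with (kap N * t + - (G N t - 0 - t))%C by ring.
    eapply Rle_trans; [apply Cmod_triangle|]. rewrite Cmod_opp, Cmod_mult.
    assert (H0 := Cmod_ge_0 t). nra.
  - rewrite E2, E3. replace (t - t)%C with (RtoC 0) by ring. rewrite Cmod_0. nra.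
  - intros j Hj H1 H2. rewrite !(truncated_step G kap t _ j) by lia.
    eapply Rle_trans; [apply (near_identity_step G kap (2 * T) m); trivial; try lia|].
    + apply (truncated_bound G kap t T N m); trivial; lia.
    + apply (truncated_bound G kap t T (S N) m); trivial; lia.
    + assert (Hq := half_pow_bounds j).
      assert (0 <= (1/2) ^ j / 4 * (T * (1/2) ^ N / 4)) by (apply Rmult_le_pos; nra).
      lra. }
destruct (geometric_Cauchy (fun k => truncated G kap t (n + k) n) (T * (1/2) ^ n / 2)) as [l [Hl Hb]].
{ intro k. rewrite Cmod_minus_sym, Nat.add_succ_r.
  eapply Rle_trans; [apply HD; lia|]. rewrite pow_add. lra. }
exists l. split.
- intros eps He. destruct (Hl eps He) as [N HN]. exists (n + N)%nat. intros p Hp.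
  replace p with (n + (p - n))%nat by lia. apply HN. lia.
- specialize (Hb 0%nat). simpl in Hb. rewrite Nat.add_0_r in Hb.
  rewrite (proj1 (truncated_end G kap t n)) in Hb. lra.
Qed.

Lemma continuous_Ctends g Y a : continuousC g -> Ctends Y a -> Ctends (fun N => g (Y N)) (g a).
Proof.
intros Hg Ha eps He. destruct (Hg a eps He) as [d [Hd H]].
destruct (Ha d Hd) as [N HN]. exists N. intros n Hn. apply H, HN, Hn.
Qed.

Lemma Ctends_eventually Y Y' a : (exists N, forall n, (N <= n)%nat -> Y n = Y' n) ->
  Ctends Y' a -> Ctends Y a.
Proof.
intros [N HN] H eps He. destruct (H eps He) as [N' HN']. exists (N + N')%nat.
intros n Hn. rewrite HN by lia. apply HN'. lia.
Qed.

Lemma Ctends_lincomb Y Y' a b k : Ctends Y a -> Ctends Y' b ->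
  Ctends (fun n => Y n - k * Y' n)%C (a - k * b)%C.
Proof.
intros Ha Hb eps He. assert (Hk := Cmod_ge_0 k).
destruct (Ha (eps/2)) as [N1 H1]; [lra|].
destruct (Hb (eps/2 / (Cmod k + 1))) as [N2 H2].
{ apply Rdiv_lt_0_compat; lra. }
exists (N1 + N2)%nat. intros n Hn. specialize (H1 n ltac:(lia)). specialize (H2 n ltac:(lia)).
replace (Y n - k * Y' n - (a - k * b))%C with ((Y n - a) + - (k * (Y' n - b)))%C by ring.
eapply Rle_trans; [apply Cmod_triangle|]. rewrite Cmod_opp, Cmod_mult.
assert (H0 := Cmod_ge_0 (Y' n - b)).
apply Rmult_le_compat_l with (r := Cmod k + 1) in H2; [|lra].
replace ((Cmod k + 1) * (eps / 2 / (Cmod k + 1))) with (eps / 2) in H2 by (field; lra).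
nra.
Qed.

(** The solution is the pointwise limit of the truncated ones; continuity of G_n passes the
    recursion to the limit. *)
Lemma solution_exists G kap t T m : (forall n, G n (RtoC 0) = RtoC 0) -> (forall n, continuousC (G n)) ->
  near_identity G kap (2 * T) m -> Cmod t <= T ->
  exists Y, solves G kap Y /\ Ctends Y t /\ forall n, (m <= n)%nat -> Cmod (Y n) <= 2 * T.
Proof.
intros HG0 HGc HG Ht.
assert (HT : 0 <= T) by (eapply Rle_trans; [apply Cmod_ge_0|exact Ht]).
set (conv := fun n l => Ctends (fun N => truncated G kap t N n) l).
assert (Hstep : forall n a b, conv (S n) a -> conv (S (S n)) b -> conv n (G n a - kap n * b)%C).
{ intros n a b Ha Hb.
  apply Ctends_eventually with (2 := Ctends_lincomb _ _ _ _ (kap n) (continuous_Ctends _ _ _ (HGc n) Ha) Hb).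
  exists (S n). intros N HN. apply truncated_step. lia. }
(* Below m no estimate holds; convergence there follows from convergence at the next two indices. *)
assert (Hconv : forall j n, (m <= n + j)%nat -> exists l, conv n l).
{ induction j as [|j IH]; intros n Hn.
  - destruct (truncated_limit G kap t T m HG0 HG Ht n ltac:(lia)) as [l [Hl _]]. now exists l.
  - destruct (IH (S n) ltac:(lia)) as [a Ha]. destruct (IH (S (S n)) ltac:(lia)) as [b Hb].
    eexists. apply (Hstep n a b Ha Hb). }
set (Y := fun n => proj1_sig (constructive_indefinite_description _ (Hconv m n ltac:(lia)))).
assert (HY : forall n, conv n (Y n)) by (intro n; apply proj2_sig).
clearbody Y.
exists Y. split; [|split].
- intro n. apply (Ctends_unique _ _ _ (HY n)). now apply Hstep.
- intros eps He. destruct (pow_half_small (eps / (T + 1))) as [N HN].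
  { apply Rdiv_lt_0_compat; lra. }
  exists (N + m)%nat. intros n Hn.
  destruct (truncated_limit G kap t T m HG0 HG Ht n ltac:(lia)) as [l [Hl Hb]].
  rewrite (Ctends_unique _ _ _ (HY n) Hl), Cmod_minus_sym.
  eapply Rle_trans; [exact Hb|].
  assert (HN' := HN n ltac:(lia)). assert (Hq := half_pow_bounds n).
  apply Rmult_le_compat_l with (r := T + 1) in HN'; [|lra].
  replace ((T + 1) * (eps / (T + 1))) with eps in HN' by (field; lra). nra.
- intros n Hn. apply (Ctends_le _ _ _ (HY n)).
  exists n. intros N HN. apply (truncated_bound G kap t T N m); trivial; lia.
Qed.

Lemma Ctends_bounded Y t T : Ctends Y t -> Cmod t < T -> exists m, forall n, (m <= n)%nat -> Cmod (Y n) <= T.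
Proof.
intros H Ht. destruct (H (T - Cmod t)) as [N HN]; [lra|]. exists N. intros n Hn.
specialize (HN n Hn). replace (Y n) with (Y n - t + t)%C by ring.
eapply Rle_trans; [apply Cmod_triangle|]. lra.
Qed.

Lemma near_identity_mono G kap T T' m m' : near_identity G kap T m -> T' <= T -> (m <= m')%nat ->
  near_identity G kap T' m'.
Proof.
intros H HT Hm n Hn. destruct (H n ltac:(lia)) as [H1 H2]. split; trivial.
intros; apply H2; lra.
Qed.

(** The strict inequality makes |Y_n - Y'_n| <= B for all late n, where the downward induction can
    start. *)
Lemma solution_lipschitz G kap T m Y Y' t t' B : near_identity G kap T m ->
  solves G kap Y -> solves G kap Y' -> Ctends Y t -> Ctends Y' t' ->
  (forall n, (m <= n)%nat -> Cmod (Y n) <= T) -> (forall n, (m <= n)%nat -> Cmod (Y' n) <= T) ->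
  Cmod (t - t') < B -> forall n, (m <= n)%nat -> Cmod (Y n - Y' n) <= 2 * B.
Proof.
intros HG HY HY' Ht Ht' Hb Hb' HB n Hn.
assert (HB0 : 0 <= B) by (assert (H := Cmod_ge_0 (t - t')); lra).
assert (HD : Ctends (fun n => Y n - Y' n)%C (t - t')%C).
{ replace (t - t')%C with (t - 1 * t')%C by ring.
  apply Ctends_eventually with (2 := Ctends_lincomb _ _ _ _ 1 Ht Ht').
  exists 0%nat. intros; ring. }
destruct (Ctends_bounded _ _ _ HD HB) as [N HN].
apply (backward_bound (fun n => Cmod (Y n - Y' n)) B m (N + n)); trivial; try lia.
- apply HN; lia.
- apply HN; lia.
- intros k Hk _ _. rewrite (HY k), (HY' k).
  eapply Rle_trans; [apply (near_identity_step G kap T m); trivial; try lia|].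
  + apply Hb; lia.
  + apply Hb'; lia.
  + assert (Hq := half_pow_bounds k).
    assert (0 <= (1/2) ^ k / 4 * B) by nra. lra.
Qed.

(** For large n the Lipschitz bound applies with t = t' and B arbitrarily small; the recursion
    carries equality to the smaller indices. *)
Lemma solution_unique G kap Y Y' t : (forall T, exists m, near_identity G kap T m) ->
  solves G kap Y -> solves G kap Y' -> Ctends Y t -> Ctends Y' t -> forall n, Y n = Y' n.
Proof.
intros HG HY HY' Ht Ht'.
destruct (HG (Cmod t + 1)) as [m Hm].
destruct (Ctends_bounded Y t (Cmod t + 1) Ht) as [m1 H1]; [lra|].
destruct (Ctends_bounded Y' t (Cmod t + 1) Ht') as [m2 H2]; [lra|].
assert (K : forall j n, (m + m1 + m2 <= n + j)%nat -> Y n = Y' n).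
{ induction j as [|j IH]; intros n Hn.
  - apply Cmod_le_eps_eq. intros eps He.
    replace eps with (2 * (eps / 2)) by field.
    apply (solution_lipschitz G kap (Cmod t + 1) (m + m1 + m2) Y Y' t t); trivial; try lia.
    + apply near_identity_mono with (1 := Hm); [lra|lia].
    + intros; apply H1; lia.
    + intros; apply H2; lia.
    + replace (t - t)%C with (RtoC 0) by ring. rewrite Cmod_0. lra.
  - rewrite (HY n), (HY' n), (IH (S n)), (IH (S (S n))) by lia. reflexivity. }
intro n. apply (K (m + m1 + m2)%nat). lia.
Qed.

(** * Rules for derivatives, and dependence of solutions on their limit *)

Lemma cderiv_ext f g z l : (forall y, f y = g y) -> cderiv f z l -> cderiv g z l.
Proof.
intros E H eps He. destruct (H eps He) as [d [Hd K]]. exists d. split; trivial.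
intros h Hh. rewrite <- !E. now apply K.
Qed.

Lemma cderiv_comp g f z a b : cderiv f z a -> cderiv g (f z) b ->
  cderiv (fun y => g (f y)) z (b * a)%C.
Proof.
intros Hf Hg eps He.
assert (Ha := Cmod_ge_0 a). assert (Hb := Cmod_ge_0 b).
set (e1 := Rmin 1 (eps / (2 * (Cmod b + 1)))).
assert (He1 : 0 < e1) by (apply Rmin_glb_lt; [lra|apply Rdiv_lt_0_compat; lra]).
set (e2 := eps / (2 * (Cmod a + 1))).
assert (He2 : 0 < e2) by (apply Rdiv_lt_0_compat; lra).
destruct (Hf e1 He1) as [d1 [Hd1 K1]]. destruct (Hg e2 He2) as [d2 [Hd2 K2]].
assert (Hq : 0 < d2 / (Cmod a + 1)) by (apply Rdiv_lt_0_compat; lra).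
exists (Rmin d1 (d2 / (Cmod a + 1))). split; [apply Rmin_glb_lt; lra|].
intros h Hh. assert (Hh0 := Cmod_ge_0 h).
assert (Hh1 : Cmod h < d1) by (eapply Rlt_le_trans; [exact Hh|apply Rmin_l]).
assert (Hh2 : Cmod h < d2 / (Cmod a + 1)) by (eapply Rlt_le_trans; [exact Hh|apply Rmin_r]).
specialize (K1 h Hh1).
set (k := (f (z + h) - f z)%C) in *.
assert (e1 <= 1) by apply Rmin_l.
assert (He1b : e1 <= eps / (2 * (Cmod b + 1))) by apply Rmin_r.
assert (Hk : Cmod k <= (Cmod a + 1) * Cmod h).
{ replace k with ((k - a * h) + a * h)%C by ring.
  eapply Rle_trans; [apply Cmod_triangle|]. rewrite Cmod_mult. nra. }
assert (Hk2 : Cmod k < d2).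
{ eapply Rle_lt_trans; [exact Hk|].
  apply Rmult_lt_compat_l with (r := Cmod a + 1) in Hh2; [|lra].
  replace ((Cmod a + 1) * (d2 / (Cmod a + 1))) with d2 in Hh2 by (field; lra). exact Hh2. }
specialize (K2 k Hk2).
replace (f (z + h)%C) with (f z + k)%C by (unfold k; ring).
replace (g (f z + k) - g (f z) - b * a * h)%C with
  ((g (f z + k) - g (f z) - b * k) + b * (k - a * h))%C by ring.
eapply Rle_trans; [apply Cmod_triangle|]. rewrite Cmod_mult.
assert (H1 : e2 * Cmod k <= eps / 2 * Cmod h).
{ apply Rle_trans with (e2 * ((Cmod a + 1) * Cmod h)).
  - apply Rmult_le_compat_l; lra.
  - apply Req_le. unfold e2. field. lra. }
assert (H2 : Cmod b * (e1 * Cmod h) <= eps / 2 * Cmod h).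
{ rewrite <- Rmult_assoc. apply Rmult_le_compat_r; trivial.
  apply Rmult_le_compat_l with (r := Cmod b + 1) in He1b; [|lra].
  replace ((Cmod b + 1) * (eps / (2 * (Cmod b + 1)))) with (eps / 2) in He1b by (field; lra).
  nra. }
assert (Cmod b * Cmod (k - a * h) <= Cmod b * (e1 * Cmod h)) by (apply Rmult_le_compat_l; trivial).
lra.
Qed.

Lemma cderiv_lincomb f g z a b k : cderiv f z a -> cderiv g z b ->
  cderiv (fun y => f y - k * g y)%C z (a - k * b)%C.
Proof.
intros Hf Hg eps He. assert (Hk := Cmod_ge_0 k).
destruct (Hf (eps/2) ltac:(lra)) as [d1 [Hd1 K1]].
assert (He2 : 0 < eps / 2 / (Cmod k + 1)) by (apply Rdiv_lt_0_compat; lra).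
destruct (Hg _ He2) as [d2 [Hd2 K2]].
exists (Rmin d1 d2). split; [apply Rmin_glb_lt; lra|]. intros h Hh.
assert (Hh0 := Cmod_ge_0 h).
specialize (K1 h (Rlt_le_trans _ _ _ Hh (Rmin_l _ _))).
specialize (K2 h (Rlt_le_trans _ _ _ Hh (Rmin_r _ _))).
match goal with |- Cmod ?x <= _ => replace x with
  ((f (z + h)%C - f z - a * h) + - (k * (g (z + h)%C - g z - b * h)))%C by ring end.
eapply Rle_trans; [apply Cmod_triangle|]. rewrite Cmod_opp, Cmod_mult.
assert (H0 := Cmod_ge_0 (g (z + h)%C - g z - b * h)).
apply Rmult_le_compat_l with (r := Cmod k + 1) in K2; [|lra].
replace ((Cmod k + 1) * (eps / 2 / (Cmod k + 1) * Cmod h)) with (eps / 2 * Cmod h) in K2 by (field; lra).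
nra.
Qed.

Lemma cderiv_affine a b z : cderiv (fun y => a + b * y)%C z b.
Proof.
intros eps He. exists 1. split; [lra|]. intros h _.
match goal with |- Cmod ?x <= _ => replace x with (RtoC 0) by ring end.
rewrite Cmod_0. assert (H := Cmod_ge_0 h). nra.
Qed.

Lemma cderiv_continuous g : (forall y, exists l, cderiv g y l) -> continuousC g.
Proof.
intros H y eps He. destruct (H y) as [l Hl]. assert (Hl0 := Cmod_ge_0 l).
destruct (Hl 1 ltac:(lra)) as [d [Hd K]].
assert (Hq : 0 < eps / (Cmod l + 1)) by (apply Rdiv_lt_0_compat; lra).
exists (Rmin (d / 2) (eps / (Cmod l + 1))). split; [apply Rmin_glb_lt; lra|].
intros y' Hy.
assert (Hy1 : Cmod (y' - y) <= d / 2) by (eapply Rle_trans; [exact Hy|apply Rmin_l]).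
assert (Hy2 : Cmod (y' - y) <= eps / (Cmod l + 1)) by (eapply Rle_trans; [exact Hy|apply Rmin_r]).
specialize (K (y' - y)%C ltac:(lra)).
replace (y + (y' - y))%C with y' in K by ring.
replace (g y' - g y)%C with ((g y' - g y - l * (y' - y)) + l * (y' - y))%C by ring.
eapply Rle_trans; [apply Cmod_triangle|]. rewrite Cmod_mult.
apply Rmult_le_compat_l with (r := Cmod l + 1) in Hy2; [|lra].
replace ((Cmod l + 1) * (eps / (Cmod l + 1))) with eps in Hy2 by (field; lra).
lra.
Qed.

(** Makes the linearized recursion near the identity too, so that the existence theorem yields its
    solution with limit 1. *)
Lemma cderiv_near_1 g y l r T : cderiv g y l -> Cmod y < T ->
  (forall y', Cmod y' <= T -> Cmod (g y' - g y - (y' - y)) <= r * Cmod (y' - y)) ->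
  Cmod (l - 1) <= r.
Proof.
intros Hd Hy H. apply le_epsilon. intros eps He.
destruct (Hd eps He) as [d [Hd0 K]].
set (h := Rmin (d / 2) (T - Cmod y)).
assert (Hh : 0 < h) by (apply Rmin_glb_lt; lra).
assert (Hh1 : h <= d / 2) by apply Rmin_l. assert (Hh2 : h <= T - Cmod y) by apply Rmin_r.
assert (Hm : Cmod (RtoC h) = h) by (rewrite Cmod_R, Rabs_pos_eq; lra).
specialize (K (RtoC h) ltac:(lra)). rewrite Hm in K.
specialize (H (y + h)%C). replace (y + h - y)%C with (RtoC h) in H by ring. rewrite Hm in H.
assert (Hyh : Cmod (y + h) <= T) by (eapply Rle_trans; [apply Cmod_triangle|]; lra).
specialize (H Hyh).
apply Rmult_le_reg_r with h; trivial. rewrite <- Hm at 1. rewrite <- Cmod_mult.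
replace ((l - 1) * h)%C with ((g (y + h)%C - g y - h) + - (g (y + h)%C - g y - l * h))%C by ring.
eapply Rle_trans; [apply Cmod_triangle|]. rewrite Cmod_opp. lra.
Qed.

(** The remainder Y(t+h) - Y(t) - h V satisfies the linearized recursion up to a forcing term
    O(2^(-n) |h|^2) and tends to 0 as n grows; [backward_bound] therefore makes it O(|h|^2) from m
    on. *)
Lemma solution_flow (G G' : nat -> C -> C) (kap : nat -> C) :
  (forall n, G n (RtoC 0) = RtoC 0) ->
  (forall n y, cderiv (G n) y (G' n y)) ->
  (forall T, exists m, near_identity G kap T m) ->
  (forall T, exists m K, 0 <= K /\ forall n y y', (m <= n)%nat -> Cmod y <= T -> Cmod y' <= T ->
     Cmod (G n y' - G n y - G' n y * (y' - y)) <= K * (1/2) ^ n * Cmod (y' - y) ^ 2) ->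
  exists Y : C -> nat -> C,
    (forall t, solves G kap (Y t) /\ Ctends (Y t) t) /\
    forall t, exists V, Ctends V 1 /\
      (forall n, V n = (G' n (Y t (S n)) * V (S n) - kap n * V (S (S n)))%C) /\
      forall n, cderiv (fun s => Y s n) t (V n).
Proof.
intros HG0 HGd Hnear Hsec.
assert (HGc : forall n, continuousC (G n)).
{ intro n. apply cderiv_continuous. intro y. exists (G' n y). apply HGd. }
assert (Hex : forall t, exists Y, solves G kap Y /\ Ctends Y t).
{ intro t. destruct (Hnear (2 * Cmod t)) as [m Hm].
  destruct (solution_exists G kap t (Cmod t) m) as [Y [H1 [H2 _]]]; trivial; [lra|].
  now exists Y. }
set (Y := fun t => proj1_sig (constructive_indefinite_description _ (Hex t))).
assert (HY : forall t, solves G kap (Y t) /\ Ctends (Y t) t) by (intro t; apply proj2_sig).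
clearbody Y. exists Y. split; [exact HY|]. intro t.
(* The radius T0 covers every t + h with |h| <= 1, solutions at most double it, and the extra 1
   below leaves the room that [cderiv_near_1] asks for. *)
set (T0 := Cmod t + 1). assert (Ht0 := Cmod_ge_0 t).
destruct (Hnear (2 * T0 + 1)) as [m1 Hm1].
destruct (Hsec (2 * T0 + 1)) as [m2 [K [HK Hm2]]].
set (m := (m1 + m2)%nat).
assert (Hm : near_identity G kap (2 * T0) m) by (apply near_identity_mono with (1 := Hm1); unfold m; [lra|lia]).
(* The index m must not depend on s. By uniqueness, [Y s] is the solution built with this m, which
   comes with the bound. *)
assert (HYb : forall s, Cmod s <= T0 -> forall n, (m <= n)%nat -> Cmod (Y s n) <= 2 * T0).
{ intros s Hs n Hn. destruct (HY s) as [Hs1 Hs2].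
  destruct (solution_exists G kap s T0 m HG0 HGc Hm Hs) as [Z [H1 [H2 H3]]].
  rewrite (solution_unique G kap (Y s) Z s Hnear); trivial. now apply H3. }
set (L := fun n v => (G' n (Y t (S n)) * v)%C).
assert (HL : forall T, near_identity L kap T m).
{ intros T n Hn. destruct (Hm1 n) as [H1 H2]; [unfold m in Hn; lia|].
  split; trivial. intros v v' _ _. unfold L.
  replace (G' n (Y t (S n)) * v - G' n (Y t (S n)) * v' - (v - v'))%C with
    ((G' n (Y t (S n)) - 1) * (v - v'))%C by ring.
  rewrite Cmod_mult. apply Rmult_le_compat_r; [apply Cmod_ge_0|].
  assert (Hb : Cmod (Y t (S n)) <= 2 * T0) by (apply HYb; [unfold T0; lra|lia]).
  apply cderiv_near_1 with (g := G n) (y := Y t (S n)) (T := 2 * T0 + 1); [apply HGd|lra|].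
  intros y' Hy'. apply H2; lra. }
destruct (solution_exists L kap 1 1 m) as [V [HV1 [HV2 HV3]]].
{ intro n. unfold L. ring. }
{ intro n. apply cderiv_continuous. intro y. exists (G' n (Y t (S n))).
  apply cderiv_ext with (2 := cderiv_affine 0 (G' n (Y t (S n))) y). intro; unfold L; ring. }
{ apply HL. }
{ rewrite Cmod_1. lra. }
exists V. split; [exact HV2|]. split; [exact HV1|].
assert (Hlocal : forall n, (m <= n)%nat -> cderiv (fun s => Y s n) t (V n)).
{ intros n Hn.
  assert (Hquad : forall h, Cmod h <= 1 ->
    Cmod (Y (t + h)%C n - Y t n - V n * h) <= 2 * (64 * (K + 1) * Cmod h ^ 2)).
  { intros h Hh. destruct (HY t) as [St Tt]. destruct (HY (t + h)%C) as [Sh Th].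
    assert (Htb : Cmod t <= T0) by (unfold T0; lra).
    assert (Hthb : Cmod (t + h) <= T0) by (unfold T0; eapply Rle_trans; [apply Cmod_triangle|]; lra).
    (* For h <> 0 the bounds 2 |h| and B are positive, as the eventual estimates need. *)
    destruct (Req_dec (Cmod h) 0) as [Hz|Hz].
    { apply Cmod_eq_0 in Hz. subst h. rewrite Cplus_0_r.
      replace (Y t n - Y t n - V n * 0)%C with (RtoC 0) by ring. rewrite Cmod_0. nra. }
    assert (Hh0 := Cmod_ge_0 h).
    assert (Hlip : forall k, (m <= k)%nat -> Cmod (Y (t + h)%C k - Y t k) <= 4 * Cmod h).
    { intros k Hk. replace (4 * Cmod h) with (2 * (2 * Cmod h)) by ring.
      apply (solution_lipschitz G kap (2 * T0) m (Y (t + h)%C) (Y t) (t + h)%C t); trivial.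
      - now apply HYb.
      - now apply HYb.
      - replace (t + h - t)%C with h by ring. lra. }
    (* The forcing term is at most K q (4|h|)^2 with q = 2^(-k), and has to stay below (q/4) B. *)
    set (B := 64 * (K + 1) * Cmod h ^ 2).
    assert (Hh2 : 0 < Cmod h ^ 2) by (simpl; nra).
    assert (HB : 0 < B) by (unfold B; nra).
    set (E := fun k => (Y (t + h)%C k - Y t k - V k * h)%C).
    assert (HE : Ctends E 0).
    { replace (RtoC 0) with ((t + h - 1 * t) - h * 1)%C by ring.
      eapply Ctends_eventually; [|apply (Ctends_lincomb _ _ _ _ h (Ctends_lincomb _ _ _ _ 1 Th Tt) HV2)].
      exists 0%nat. intros k _. unfold E. ring. }
    destruct (HE B HB) as [N HN].
    assert (HN' : forall k, (N <= k)%nat -> Cmod (E k) <= B).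
    { intros k Hk. replace (E k) with (E k - 0)%C by ring. now apply HN. }
    change (Cmod (E n) <= 2 * B).
    apply (backward_bound (fun k => Cmod (E k)) B m (N + n)); try lia; try (apply HN'; lia); [lra|].
    intros k Hk _ _.
    assert (HEk : E k = ((G k (Y (t + h)%C (S k)) - G k (Y t (S k)) -
         G' k (Y t (S k)) * (Y (t + h)%C (S k) - Y t (S k)))
       + ((L k (E (S k)) - kap k * E (S (S k))) - (L k 0 - kap k * 0)))%C).
    { unfold E. rewrite (Sh k), (St k), (HV1 k). unfold L. ring. }
    rewrite HEk. eapply Rle_trans; [apply Cmod_triangle|].
    assert (H1 := near_identity_step L kap (Cmod (E (S k))) m k (E (S k)) (E (S (S k))) 0 0
      (HL _) ltac:(lia) ltac:(lra) ltac:(rewrite Cmod_0; apply Cmod_ge_0)).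
    replace (E (S k) - 0)%C with (E (S k)) in H1 by ring.
    replace (E (S (S k)) - 0)%C with (E (S (S k))) in H1 by ring.
    assert (H2 := Hm2 k (Y t (S k)) (Y (t + h)%C (S k)) ltac:(unfold m in Hk; lia)).
    assert (Hb1 := HYb t Htb (S k) ltac:(lia)). assert (Hb2 := HYb (t + h)%C Hthb (S k) ltac:(lia)).
    specialize (H2 ltac:(lra) ltac:(lra)).
    assert (H3 := Hlip (S k) ltac:(lia)). assert (H3' := Cmod_ge_0 (Y (t + h)%C (S k) - Y t (S k))).
    assert (Hq := half_pow_bounds k).
    assert (H4 : Cmod (Y (t + h)%C (S k) - Y t (S k)) ^ 2 <= 16 * Cmod h ^ 2).
    { replace (16 * Cmod h ^ 2) with ((4 * Cmod h) ^ 2) by ring. apply pow_incr; lra. }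
    assert (H5 : K * (1/2) ^ k * Cmod (Y (t + h)%C (S k) - Y t (S k)) ^ 2 <= (1/2) ^ k / 4 * B).
    { apply Rle_trans with (K * (1/2) ^ k * (16 * Cmod h ^ 2)).
      - apply Rmult_le_compat_l; nra.
      - unfold B. replace ((1/2) ^ k / 4 * (64 * (K + 1) * Cmod h ^ 2)) with
          ((K + 1) * (1/2) ^ k * (16 * Cmod h ^ 2)) by field.
        apply Rmult_le_compat_r; nra. }
    lra. }
  intros eps He. set (Q := 2 * (64 * (K + 1))). assert (HQ : 0 < Q) by (unfold Q; lra).
  assert (HeQ : 0 < eps / Q) by (apply Rdiv_lt_0_compat; lra).
  exists (Rmin 1 (eps / Q)). split; [apply Rmin_glb_lt; lra|]. intros h Hh.
  assert (Hh1 := Rlt_le_trans _ _ _ Hh (Rmin_l _ _)). assert (Hh2 := Rlt_le_trans _ _ _ Hh (Rmin_r _ _)).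
  eapply Rle_trans; [apply Hquad; lra|]. assert (Hh0 := Cmod_ge_0 h).
  replace (2 * (64 * (K + 1) * Cmod h ^ 2)) with ((Q * Cmod h) * Cmod h) by (unfold Q; ring).
  apply Rmult_le_compat_r; trivial.
  apply (Rmult_lt_compat_l Q) in Hh2; trivial.
  replace (Q * (eps / Q)) with eps in Hh2 by (field; lra). lra. }
(* Below m the derivative follows from the chain rule, as V satisfies the differentiated
   recursion. *)
assert (Hall : forall j n, (m <= n + j)%nat -> cderiv (fun s => Y s n) t (V n)).
{ induction j as [|j IH]; intros n Hn.
  - apply Hlocal. lia.
  - rewrite (HV1 n).
    apply cderiv_ext with (fun s => G n (Y s (S n)) - kap n * Y s (S (S n)))%C.
    { intro s. symmetry. apply (proj1 (HY s)). }
    apply cderiv_lincomb.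
    + apply (cderiv_comp (G n) (fun s => Y s (S n)) t (V (S n)) (G' n (Y t (S n)))); [apply IH; lia|apply HGd].
    + apply IH. lia. }
intro n. apply (Hall m). lia.
Qed.

(** * Stable manifolds of expanding orbits *)

Lemma quarter_decay (u : nat -> R) m : (forall n, 0 <= u n) ->
  (forall n, (m <= n)%nat -> u (S n) <= u n / 4) ->
  exists A, 0 < A /\ forall n, u n <= A * (1/4) ^ n.
Proof.
intros Hu H. destruct (finite_bound (fun n => u n * 4 ^ n) (S m)) as [A [HA HA']].
exists (A + 1). split; [lra|].
assert (K : forall n, u n * 4 ^ n <= A).
{ induction n as [|n IH].
  - apply HA'. lia.
  - destruct (le_lt_dec m n) as [Hn|Hn]; [|apply HA'; lia].
    specialize (H n Hn). assert (0 < 4 ^ n) by (apply pow_lt; lra). simpl. nra. }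
intro n. assert (H4 : 0 < 4 ^ n) by (apply pow_lt; lra).
replace ((1/4) ^ n) with (/ 4 ^ n) by (unfold Rdiv; rewrite Rmult_1_l, pow_inv; trivial).
apply Rmult_le_reg_r with (4 ^ n); trivial.
rewrite Rmult_assoc, Rinv_l by lra. specialize (K n). lra.
Qed.

Lemma quarter_pow n : (1/4) ^ n = (1/2) ^ n * (1/2) ^ n.
Proof. rewrite <- Rpow_mult_distr. f_equal. field. Qed.

(** Half of the decay 4^(-n) is given up to absorb the constant K; this is why growth at rate 4 is
    carried through the proof while [near_identity] asks for 2^(-n). *)
Lemma quarter_small K eps : 0 <= K -> 0 < eps ->
  exists m, forall n, (m <= n)%nat -> K * (1/4) ^ n <= eps * (1/2) ^ n.
Proof.
intros HK He. destruct (pow_half_small (eps / (K + 1))) as [m Hm].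
{ apply Rdiv_lt_0_compat; lra. }
exists m. intros n Hn. specialize (Hm n Hn). rewrite quarter_pow, <- Rmult_assoc.
assert (Hq := half_pow_bounds n).
apply Rmult_le_compat_r; [lra|].
apply Rmult_le_compat_l with (r := K + 1) in Hm; [|lra].
replace ((K + 1) * (eps / (K + 1))) with eps in Hm by (field; lra). nra.
Qed.


(* [delta / lam n] is the contraction rate of the stable direction at step n. *)
Fixpoint rate (delta : C) (lam : nat -> C) (n : nat) : C :=
  match n with
  | 0 => RtoC 1
  | S n => (rate delta lam n * (delta / lam n))%C
  end.

Lemma rate_neq_0 (delta : C) (lam : nat -> C) n : delta <> 0 -> (forall k, lam k <> 0) -> rate delta lam n <> 0.
Proof.
intros Hd Hl. induction n as [|n IH]; simpl.
- apply Cmod_gt_0. rewrite Cmod_1. lra.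
- apply Cmult_neq_0; [exact IH|]. apply Cmod_gt_0. rewrite Cmod_div by apply Hl.
  apply Rdiv_lt_0_compat; apply Cmod_gt_0; [exact Hd|apply Hl].
Qed.

Lemma rate_step (delta : C) (lam : nat -> C) n : lam n <> 0 -> (lam n * rate delta lam (S n))%C = (delta * rate delta lam n)%C.
Proof. intros Hl. simpl. field. trivial. Qed.

(** The bound on f says that rho_n is a scale on which f varies by no more than its linear part, up
    to the factor L. Of the two lower bounds on f', the first gives p_n = O(4^(-n)); the second
    gives p_(n+1) = O(4^(-n) rho_n), so that a ball |Y| <= T eventually lies deep inside the disk of
    radius rho_n. *)
Lemma stable_manifold (f f' : C -> C) (a : nat -> C) (delta : C) (x : nat -> C)
    (rho : nat -> R) (L c : R) (n1 : nat) :
  taylor f a -> (forall z, cderiv f z (f' z)) -> delta <> 0 ->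
  (forall n, x (S (S n)) = (f (x (S n)) - delta * x n)%C) ->
  0 <= L -> 0 < c ->
  (forall n, (n1 <= n)%nat -> 0 < rho n) ->
  (forall n z, (n1 <= n)%nat -> Cmod (z - x (S n)) <= rho n ->
     Cmod (f z) <= L * (Cmod (f' (x (S n))) * rho n)) ->
  (forall n, (n1 <= n)%nat -> c * 4 ^ n <= Cmod (f' (x (S n)))) ->
  (forall n, (n1 <= n)%nat -> c <= Cmod (f' (x (S n))) * rho n) ->
  exists y : C -> nat -> C,
    (forall t n, y t (S (S n)) = (f (y t (S n)) - delta * y t n)%C) /\
    (forall n, y 0 n = x n) /\
    (forall s t, y s 0%nat = y t 0%nat -> y s 1%nat = y t 1%nat -> s = t) /\
    (forall t, exists v0 v1, cderiv (fun s => y s 0%nat) t v0 /\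
       cderiv (fun s => y s 1%nat) t v1 /\ ~ (v0 = 0 /\ v1 = 0)) /\
    (forall t, exists A, 0 < A /\ forall n, Cmod (y t n - x n) <= A * (1/4) ^ n).
Proof.
intros Hta Hf' Hdelta Hx HL Hc Hrho HfB Hlam4 Hlamrho.
(* Before n1 the derivative might vanish; the value 1 keeps every p_n nonzero and affects only
   finitely many factors. *)
set (lam := fun n => if lt_dec n n1 then RtoC 1 else f' (x (S n))).
assert (Hlam : forall n, (n1 <= n)%nat -> lam n = f' (x (S n))).
{ intros n Hn. unfold lam. destruct (lt_dec n n1); [lia|reflexivity]. }
assert (Hlampos : forall n, (n1 <= n)%nat -> 0 < Cmod (lam n)).
{ intros n Hn. rewrite Hlam by trivial. eapply Rlt_le_trans; [|apply Hlam4; trivial].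
  assert (0 < 4 ^ n) by (apply pow_lt; lra). nra. }
assert (Hlam0 : forall n, lam n <> 0).
{ intro n. destruct (le_lt_dec n1 n) as [Hn|Hn].
  - apply Cmod_gt_0. now apply Hlampos.
  - unfold lam. destruct (lt_dec n n1); [|lia]. apply Cmod_gt_0. rewrite Cmod_1. lra. }
clearbody lam.
set (p := rate delta lam).
assert (Hp0 : forall n, p n <> 0) by (intro n; now apply rate_neq_0).
assert (Hps : forall n, (lam n * p (S n))%C = (delta * p n)%C) by (intro n; now apply rate_step).
assert (Hp0' : p 0%nat = 1) by reflexivity.
clearbody p.
assert (Hpm : forall n, 0 < Cmod (p n)) by (intro n; now apply Cmod_gt_0).
assert (Hdm : 0 < Cmod delta) by now apply Cmod_gt_0.
assert (Hpsm : forall n, Cmod (lam n) * Cmod (p (S n)) = Cmod delta * Cmod (p n)).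
{ intro n. rewrite <- !Cmod_mult. now rewrite Hps. }
assert (Hlam4' : forall n, (n1 <= n)%nat -> c * 4 ^ n <= Cmod (lam n)).
{ intros n Hn. rewrite Hlam by trivial. now apply Hlam4. }
(* Beyond n1 + n2 one has |lam_n| >= c 4^n >= c n >= 4 |delta|, so each further factor delta / lam_n
   has modulus at most 1/4. *)
destruct (INR_unbounded (4 * Cmod delta / c)) as [n2 Hn2].
destruct (quarter_decay (fun n => Cmod (p n)) (n1 + n2)) as [Cp [HCp HCp']].
{ intro n. apply Cmod_ge_0. }
{ intros n Hn.
  assert (Hn4 : 4 * Cmod delta <= Cmod (lam n)).
  { apply Rle_trans with (c * 4 ^ n); [|apply Hlam4'; lia].
    assert (HINR : 4 * Cmod delta / c <= INR n).
    { apply Rle_trans with (INR n2); [lra|]. apply le_INR; lia. }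
    assert (H4n : INR n <= 4 ^ n).
    { clear. induction n as [|n IH]; [simpl; lra|]. rewrite S_INR. simpl.
      assert (1 <= 4 ^ n) by (apply pow_R1_Rle; lra). lra. }
    apply Rmult_le_compat_l with (r := c) in HINR; [|lra].
    replace (c * (4 * Cmod delta / c)) with (4 * Cmod delta) in HINR by (field; lra). nra. }
  assert (H := Hpsm n). assert (H0 := Hpm n). assert (H1 := Hpm (S n)).
  apply Rmult_le_reg_l with (4 * Cmod delta); [lra|]. nra. }
(* From |p_(n+1)| = |delta| |p_n| / |lam_n| with |p_n| <= Cp 4^(-n) and 1 / |lam_n| <= rho_n / c. *)
set (P := Cp * Cmod delta / c).
assert (HP : 0 < P) by (unfold P; apply Rdiv_lt_0_compat; nra).
assert (Hprho : forall n, (n1 <= n)%nat -> Cmod (p (S n)) <= P * (1/4) ^ n * rho n).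
{ intros n Hn. assert (H1 := Hlamrho n Hn). rewrite <- Hlam in H1 by trivial.
  assert (H2 := Hpsm n). assert (H3 := HCp' n). assert (H4 := Hlampos n Hn).
  assert (H5 := Hrho n Hn). assert (H6 := Hpm (S n)).
  apply Rmult_le_reg_l with (c * Cmod (lam n)); [nra|].
  replace (c * Cmod (lam n) * (P * (1/4) ^ n * rho n)) with
    ((Cp * (1/4) ^ n * Cmod delta) * (Cmod (lam n) * rho n)) by (unfold P; field; lra).
  rewrite Rmult_assoc, H2.
  assert (0 < (1/4) ^ n) by (apply pow_lt; lra).
  apply Rle_trans with (c * (Cp * (1/4) ^ n * Cmod delta)).
  - apply Rmult_le_compat_l; nra.
  - rewrite Rmult_comm. apply Rmult_le_compat_l; trivial. repeat (apply Rmult_le_pos; [|lra]); lra. }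
(* Subtract the recursion for x from that for x + p Y and solve for Y_n. Since delta p_n = lam_n
   p_(n+1), the derivative of G_n at 0 is f'(x_(n+1)) / lam_n, which is 1 from n1 on. *)
set (G := fun n y => ((f (x (S n) + p (S n) * y) - f (x (S n))) / (delta * p n))%C).
set (G' := fun n y => (f' (x (S n) + p (S n) * y) * p (S n) / (delta * p n))%C).
set (kap := fun n => (p (S (S n)) / (delta * p n))%C).
assert (Hdp : forall n, (delta * p n)%C <> 0) by (intro n; now apply Cmult_neq_0).
assert (HG0 : forall n, G n (RtoC 0) = RtoC 0).
{ intro n. unfold G. replace (x (S n) + p (S n) * 0)%C with (x (S n)) by ring. field. auto. }
assert (HGd : forall n y, cderiv (G n) y (G' n y)).
{ intros n y.
  assert (H := cderiv_comp f (fun y => x (S n) + p (S n) * y)%C y (p (S n)) _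
    (cderiv_affine (x (S n)) (p (S n)) y) (Hf' _)).
  assert (H2 := cderiv_comp (fun w => - f (x (S n)) / (delta * p n) + / (delta * p n) * w)%C _ y _ _ H
    (cderiv_affine _ _ _)).
  unfold G'. replace (f' (x (S n) + p (S n) * y) * p (S n) / (delta * p n))%C with
    (/ (delta * p n) * (f' (x (S n) + p (S n) * y) * p (S n)))%C by (unfold Cdiv; ring).
  apply cderiv_ext with (2 := H2). intro w. unfold G, Cdiv. ring. }
assert (Hkap : exists m, forall n, (m <= n)%nat -> Cmod (kap n) <= (1/2) ^ n / 16).
{ destruct (quarter_small (Cmod delta / c ^ 2) (/16)) as [m Hm]; [|lra|].
  { apply Rlt_le, Rdiv_lt_0_compat; trivial. apply pow_lt; trivial. }
  exists (m + n1)%nat. intros n Hn. specialize (Hm n ltac:(lia)).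
  eapply Rle_trans; [|apply Rle_trans with (1 := Hm); lra].
  replace (kap n) with (delta / (lam n * lam (S n)))%C.
  2:{ unfold kap. assert (E1 := Hps n). assert (E2 := Hps (S n)).
    assert (E3 : p (S (S n)) = (delta * (delta * p n) / (lam n * lam (S n)))%C).
    { rewrite <- E1. replace (delta * (lam n * p (S n)))%C with (lam n * (delta * p (S n)))%C by ring.
      rewrite <- E2. field. split; auto. }
    rewrite E3. field. repeat split; auto. }
  rewrite Cmod_div, Cmod_mult by (apply Cmult_neq_0; auto).
  assert (H1 := Hlam4' n ltac:(lia)). assert (H2 := Hlam4' (S n) ltac:(lia)).
  assert (H4 : 1 <= 4 ^ n) by (apply pow_R1_Rle; lra).
  assert (Hc1 : c <= Cmod (lam (S n))) by (simpl in H2; nra).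
  assert (0 < c ^ 2) by (apply pow_lt; trivial).
  replace ((1/4) ^ n) with (/ 4 ^ n) by (unfold Rdiv; rewrite Rmult_1_l, pow_inv; trivial).
  unfold Rdiv. rewrite Rmult_assoc. apply Rmult_le_compat_l; [lra|].
  rewrite <- Rinv_mult. apply Rinv_le_contravar; [nra|].
  simpl. rewrite Rmult_1_r.
  replace (c * c * 4 ^ n) with ((c * 4 ^ n) * c) by ring.
  apply Rmult_le_compat; nra. }
destruct Hkap as [mk Hkap].
assert (Hnear0 : forall T, 0 < T -> exists m, near_identity G kap T m).
{ intros T HT.
  (* The constant results from [taylor_second_order] with B = L |lam_n| rho_n and M = |p_(n+1)| T;
     the index m3 below ensures M <= rho_n / 2. *)
  destruct (quarter_small (6 * L * T * P) (/16)) as [m2 Hm2]; [|lra|].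
  { repeat (apply Rmult_le_pos; [|lra]); lra. }
  destruct (quarter_small (T * P) (/2)) as [m3 Hm3]; [|lra|].
  { repeat (apply Rmult_le_pos; [|lra]); lra. }
  exists (n1 + mk + m2 + m3)%nat. intros n Hn. split; [apply Hkap; lia|].
  intros y y' Hy Hy'.
  specialize (Hm2 n ltac:(lia)). specialize (Hm3 n ltac:(lia)).
  assert (Hr := Hrho n ltac:(lia)). assert (Hpr := Hprho n ltac:(lia)).
  assert (Hq := half_pow_bounds n). assert (Hpn := Hpm (S n)).
  assert (Hln := Hlampos n ltac:(lia)). assert (Hyy := Cmod_ge_0 (y - y')).
  unfold G. rewrite <- Hps.
  replace ((f (x (S n) + p (S n) * y) - f (x (S n))) / (lam n * p (S n)) -
      (f (x (S n) + p (S n) * y') - f (x (S n))) / (lam n * p (S n)) - (y - y'))%C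
    with ((f (x (S n) + p (S n) * y) - f (x (S n) + p (S n) * y') -
       lam n * (p (S n) * y - p (S n) * y')) / (lam n * p (S n)))%C by (field; auto).
  rewrite Cmod_div, Cmod_mult by (apply Cmult_neq_0; auto).
  rewrite (Hlam n) by lia.
  eapply Rle_trans.
  { apply Rmult_le_compat_r; [rewrite <- Hlam by lia; apply Rlt_le, Rinv_0_lt_compat; nra|].
    apply (taylor_second_order f a (x (S n)) (f' (x (S n))) (rho n)
      (L * (Cmod (f' (x (S n))) * rho n)) (Cmod (p (S n)) * T)); trivial.
    - intros z Hz. apply HfB; [lia|lra].
    - apply Rle_trans with (P * (1/4) ^ n * rho n * T); [apply Rmult_le_compat_r; lra|].
      assert (T * P * (1/4) ^ n <= / 2) by lra. nra.
    - rewrite Cmod_mult. apply Rmult_le_compat_l; lra.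
    - rewrite Cmod_mult. apply Rmult_le_compat_l; lra. }
  replace (p (S n) * y - p (S n) * y')%C with (p (S n) * (y - y'))%C by ring.
  rewrite Cmod_mult, <- Hlam by lia.
  replace (6 * (L * (Cmod (lam n) * rho n)) / rho n ^ 2 * (Cmod (p (S n)) * T) *
     (Cmod (p (S n)) * Cmod (y - y')) * / (Cmod (lam n) * Cmod (p (S n))))
    with (6 * L * T * (Cmod (p (S n)) / rho n) * Cmod (y - y')) by (field; lra).
  apply Rmult_le_compat_r; trivial.
  assert (Cmod (p (S n)) / rho n <= P * (1/4) ^ n).
  { apply Rmult_le_reg_r with (rho n); trivial. unfold Rdiv at 1.
    rewrite Rmult_assoc, Rinv_l; lra. }
  apply Rle_trans with (6 * L * T * (P * (1/4) ^ n)); [|lra].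
  apply Rmult_le_compat_l; trivial. repeat (apply Rmult_le_pos; [|lra]); lra. }
assert (Hnear : forall T, exists m, near_identity G kap T m).
{ intro T. destruct (Hnear0 (Rabs T + 1)) as [m Hm]; [assert (H := Rabs_pos T); lra|].
  exists m. apply near_identity_mono with (1 := Hm); [|lia]. assert (H := Rle_abs T). lra. }
assert (Hsec : forall T, exists m K, 0 <= K /\ forall n y y', (m <= n)%nat -> Cmod y <= T -> Cmod y' <= T ->
     Cmod (G n y' - G n y - G' n y * (y' - y)) <= K * (1/2) ^ n * Cmod (y' - y) ^ 2).
{ intros T.
  (* With |p_(n+1)| T <= rho_n / 8, the circle of radius rho_n / 2 around the new centre z stays
     within rho_n of x_(n+1), and increments are at most rho_n / 4, half that radius. Halving the
     radius turns 6 into 24. *)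
  destruct (quarter_small (Rabs T * P) (/8)) as [m3 Hm3]; [|lra|].
  { assert (H := Rabs_pos T). repeat (apply Rmult_le_pos; [|lra]); lra. }
  exists (n1 + m3)%nat, (24 * L * P). split; [repeat (apply Rmult_le_pos; [|lra]); lra|].
  intros n y y' Hn Hy Hy'.
  rewrite Rabs_pos_eq in Hm3 by (eapply Rle_trans; [apply Cmod_ge_0|exact Hy]).
  specialize (Hm3 n ltac:(lia)).
  assert (Hr := Hrho n ltac:(lia)). assert (Hpr := Hprho n ltac:(lia)).
  assert (Hq := half_pow_bounds n). assert (Hpn := Hpm (S n)).
  assert (Hln := Hlampos n ltac:(lia)). assert (Hyy := Cmod_ge_0 (y' - y)).
  assert (HpT : Cmod (p (S n)) * T <= rho n / 8).
  { apply Rle_trans with (P * (1/4) ^ n * rho n * T).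
    - apply Rmult_le_compat_r; trivial. eapply Rle_trans; [apply Cmod_ge_0|exact Hy].
    - assert (T * P * (1/4) ^ n <= / 8) by lra. nra. }
  assert (Hyd : Cmod (y' - y) <= 2 * T).
  { unfold Cminus. eapply Rle_trans; [apply Cmod_triangle|]. rewrite Cmod_opp. lra. }
  unfold G, G'. rewrite <- Hps. set (z := (x (S n) + p (S n) * y)%C).
  replace (x (S n) + p (S n) * y')%C with (z + p (S n) * (y' - y))%C by (unfold z; ring).
  replace ((f (z + p (S n) * (y' - y)) - f (x (S n))) / (lam n * p (S n)) -
      (f z - f (x (S n))) / (lam n * p (S n)) - f' z * p (S n) / (lam n * p (S n)) * (y' - y))%C
    with ((f (z + p (S n) * (y' - y)) - f (z + 0) -
       f' z * (p (S n) * (y' - y) - 0)) / (lam n * p (S n)))%C.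
  2:{ rewrite Cplus_0_r. field. auto. }
  rewrite Cmod_div, Cmod_mult by (apply Cmult_neq_0; auto).
  assert (Hpy : Cmod (p (S n) * (y' - y)) <= rho n / 4).
  { rewrite Cmod_mult. apply Rle_trans with (Cmod (p (S n)) * (2 * T)); [|lra].
    apply Rmult_le_compat_l; lra. }
  eapply Rle_trans.
  { apply Rmult_le_compat_r; [apply Rlt_le, Rinv_0_lt_compat; nra|].
    (* Taking M to be the modulus of the increment itself is what makes the bound quadratic. *)
    apply (taylor_second_order f a z (f' z) (rho n / 2)
      (L * (Cmod (f' (x (S n))) * rho n)) (Cmod (p (S n) * (y' - y)))); trivial.
    - lra.
    - intros w Hw. apply HfB; [lia|].
      replace (w - x (S n))%C with ((w - z) + p (S n) * y)%C by (unfold z; ring).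
      eapply Rle_trans; [apply Cmod_triangle|]. rewrite Hw, Cmod_mult.
      assert (Cmod (p (S n)) * Cmod y <= Cmod (p (S n)) * T) by (apply Rmult_le_compat_l; lra). lra.
    - lra.
    - lra.
    - rewrite Cmod_0. apply Cmod_ge_0. }
  replace (p (S n) * (y' - y) - 0)%C with (p (S n) * (y' - y))%C by ring.
  rewrite !Cmod_mult, <- Hlam by lia.
  match goal with |- ?l <= _ => replace l
    with (24 * L * (Cmod (p (S n)) / rho n) * Cmod (y' - y) ^ 2) by (field; lra) end.
  apply Rmult_le_compat_r; [apply pow_le; trivial|].
  assert (Cmod (p (S n)) / rho n <= P * (1/4) ^ n).
  { apply Rmult_le_reg_r with (rho n); trivial. unfold Rdiv at 1.
    rewrite Rmult_assoc, Rinv_l; lra. }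
  assert (Hq4 : (1/4) ^ n <= (1/2) ^ n) by (rewrite quarter_pow; nra).
  rewrite !(Rmult_assoc (24 * L)). apply Rmult_le_compat_l; [lra|].
  apply Rle_trans with (1 := H). apply Rmult_le_compat_l; lra. }
destruct (solution_flow G G' kap HG0 HGd Hnear Hsec) as [Y [HY HYd]].
set (y := fun t n => (x n + p n * Y t n)%C).
assert (Hrec : forall t n, y t (S (S n)) = (f (y t (S n)) - delta * y t n)%C).
{ intros t n. unfold y. rewrite Hx, (proj1 (HY t) n). unfold G, kap. field. auto. }
assert (Hkap0 : forall n, kap n <> 0).
{ intro n. unfold kap. apply Cmod_gt_0. rewrite Cmod_div by auto.
  apply Rdiv_lt_0_compat; [apply Hpm|]. now apply Cmod_gt_0. }
exists y. split; [exact Hrec|]. split; [|split; [|split]].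
- intro n. unfold y.
  rewrite (solution_unique G kap (Y 0) (fun _ => RtoC 0) 0 Hnear); try apply HY.
  + ring.
  + intro k. rewrite HG0. ring.
  + intros eps He. exists 0%nat. intros k _. replace (0 - 0)%C with (RtoC 0) by ring.
    rewrite Cmod_0. lra.
- intros s t H0 H1.
  assert (Hall : forall n, y s n = y t n /\ y s (S n) = y t (S n)).
  { induction n as [|n [IH1 IH2]]; [now split|]. split; trivial.
    now rewrite !Hrec, IH1, IH2. }
  apply (Ctends_unique (Y s)); [apply HY|].
  apply Ctends_eventually with (Y t); [|apply HY].
  exists 0%nat. intros n _. destruct (Hall n) as [E _]. unfold y in E.
  replace (Y s n) with ((x n + p n * Y s n - x n) / p n)%C by (field; auto).
  rewrite E. field. auto.
- intro t. destruct (HYd t) as [V [HV1 [HV2 HV3]]].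
  assert (HVd : forall n, cderiv (fun s => y s n) t (p n * V n)%C).
  { intro n. apply (cderiv_comp (fun w => x n + p n * w)%C (fun s => Y s n) t _ _ (HV3 n)).
    apply cderiv_affine. }
  exists (p 0%nat * V 0%nat)%C, (p 1%nat * V 1%nat)%C.
  split; [apply HVd|]. split; [apply HVd|]. intros [E0 E1].
  assert (Hz : forall n, (p n * V n)%C = 0 -> V n = 0).
  { intros n E. replace (V n) with (p n * V n / p n)%C by (field; auto). rewrite E. field. auto. }
  (* As kap_n <> 0, two consecutive zeros force all later values to vanish, contrary to V_n -> 1. *)
  assert (Hall : forall n, V n = 0 /\ V (S n) = 0).
  { induction n as [|n [IH1 IH2]]; [split; auto|]. split; trivial.
    assert (E := HV2 n). rewrite IH1, IH2 in E.
    replace (V (S (S n))) with (kap n * V (S (S n)) / kap n)%C by (field; auto).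
    replace (kap n * V (S (S n)))%C with
      (- (G' n (Y t (S n)) * 0 - kap n * V (S (S n))) + G' n (Y t (S n)) * 0)%C by ring.
    rewrite <- E. field. auto. }
  assert (E : (1 : C) = 0).
  { apply (Ctends_unique V); trivial. intros eps He. exists 0%nat. intros n _.
    rewrite (proj1 (Hall n)). replace (0 - 0)%C with (RtoC 0) by ring. rewrite Cmod_0. lra. }
  apply (f_equal Cmod) in E. rewrite Cmod_1, Cmod_0 in E. lra.
- intro t. destruct (HY t) as [_ Ht].
  destruct (Ctends_bounded (Y t) t (Cmod t + 1) Ht) as [m Hm]; [lra|].
  destruct (finite_bound (fun n => Cmod (Y t n)) m) as [A [HA HA']].
  assert (Ht0 := Cmod_ge_0 t).
  set (A' := A + (Cmod t + 1)).
  assert (HYb : forall n, Cmod (Y t n) <= A').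
  { intro n. unfold A'. destruct (le_lt_dec m n) as [Hn|Hn].
    - specialize (Hm n Hn). lra.
    - specialize (HA' n Hn). lra. }
  exists (Cp * A'). split; [unfold A'; nra|]. intro n.
  unfold y. replace (x n + p n * Y t n - x n)%C with (p n * Y t n)%C by ring.
  rewrite Cmod_mult. assert (H1 := HCp' n). assert (H2 := HYb n).
  replace (Cp * A' * (1/4) ^ n) with ((Cp * (1/4) ^ n) * A') by ring.
  apply Rmult_le_compat; trivial; apply Cmod_ge_0.
Qed.

(** * Wiman-Valiron estimates *)

Lemma taylor_coeff_nonzero f a k0 : taylor f a -> ~ polynomial_fun f ->
  exists k, (k0 <= k)%nat /\ a k <> 0.
Proof.
intros Ht Hf. destruct (classic (exists k, (k0 <= k)%nat /\ a k <> 0)) as [H|H]; trivial.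
exfalso. apply Hf. exists k0, a. intro z. change (f z = polyC a k0 z).
assert (Hz : forall j, polyC a (k0 + j) z = polyC a k0 z).
{ induction j as [|j IH]; [now rewrite Nat.add_0_r|].
  rewrite Nat.add_succ_r, polyC_S, IH.
  destruct (classic (a (S (k0 + j)) = 0)) as [E|E].
  - rewrite E. ring.
  - exfalso. apply H. exists (S (k0 + j)). split; [lia|trivial]. }
apply Cmod_le_eps_eq. intros eps He. destruct (Ht z eps He) as [N HN].
rewrite Cmod_minus_sym, <- (Hz N). apply HN. lia.
Qed.

(** Fix a nonzero coefficient a_k with k >= k0 and a bound B for all coefficients. Once r >= B /
    |a_k|, the term of index k is at least as large as every term of index below k0, while terms
    beyond the central index are strictly smaller than the maximal one. *)
Lemma central_index_unbounded f a A : taylor f a -> ~ polynomial_fun f ->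
  exists r0, forall r N, r0 <= r -> is_central_index a r N -> A <= INR N.
Proof.
intros Ht Hf. destruct (INR_unbounded A) as [k0 Hk0].
destruct (taylor_coeff_nonzero f a k0 Ht Hf) as [k [Hk Hak]].
apply Cmod_gt_0 in Hak.
destruct (taylor_bound f a 1 Ht ltac:(lra)) as [B [HB Hb]].
exists (Rmax 1 (B / Cmod (a k))). intros r N Hr [_ HN].
assert (Hr1 : 1 <= r) by (eapply Rle_trans; [apply Rmax_l|exact Hr]).
assert (Hr2 : B / Cmod (a k) <= r) by (eapply Rle_trans; [apply Rmax_r|exact Hr]).
destruct (le_lt_dec k0 N) as [H|H].
{ apply le_INR in H. lra. }
exfalso. specialize (HN k ltac:(lia)).
assert (Hb' := Hb N). rewrite pow1, Rmult_1_r in Hb'.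
assert (Hp : 0 < r ^ N) by (apply pow_lt; lra).
assert (Hpk : r * r ^ N <= r ^ k) by (apply (Rle_pow r (S N) k); [lra|lia]).
assert (HBr : B <= Cmod (a k) * r).
{ apply Rmult_le_compat_l with (r := Cmod (a k)) in Hr2; [|lra].
  replace (Cmod (a k) * (B / Cmod (a k))) with B in Hr2 by (field; lra). exact Hr2. }
assert (Cmod (a k) * (r * r ^ N) <= Cmod (a k) * r ^ k) by (apply Rmult_le_compat_l; lra).
assert (Cmod (a N) * r ^ N <= B * r ^ N) by (apply Rmult_le_compat_r; lra).
assert (B * r ^ N <= Cmod (a k) * r * r ^ N) by (apply Rmult_le_compat_r; lra).
lra.
Qed.

(** Liouville's argument: if f differs by d > 0 from its affine part at some u, the second-order
    estimate on the circle of radius r gives d <= 6 m |u|^2 / r^2. *)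
Lemma max_modulus_quadratic f a l : taylor f a -> cderiv f 0 l -> ~ polynomial_fun f ->
  exists c r0, 0 < c /\ forall r m, r0 <= r -> is_max_modulus f r m -> c * r ^ 2 <= m.
Proof.
intros Ht Hl Hf.
destruct (classic (exists u, f u <> (f 0 + l * u)%C)) as [[u Hu]|H].
2:{ exfalso. apply Hf. exists 1%nat, (fun k => match k with O => f 0 | _ => l end).
  intro z. change (f z = polyC (fun k => match k with O => f 0 | _ => l end) 1 z).
  rewrite polyC_S, polyC_0, Cpow_1_r.
  destruct (classic (f z = (f 0 + l * z)%C)) as [E|E]; trivial.
  exfalso. apply H. now exists z. }
set (d := Cmod (f u - f 0 - l * u)).
assert (Hd : 0 < d).
{ apply Cmod_gt_0. intro E. apply Hu.
  replace (f u) with ((f u - f 0 - l * u) + (f 0 + l * u))%C by ring. rewrite E. ring. }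
assert (Hu0 : 0 < Cmod u).
{ apply Cmod_gt_0. intro E. apply Hu. rewrite E. ring. }
assert (Hu2 : 0 < 6 * Cmod u ^ 2) by (assert (0 < Cmod u ^ 2) by (apply pow_lt; trivial); lra).
exists (d / (6 * Cmod u ^ 2)), (2 * Cmod u). split; [now apply Rdiv_lt_0_compat|].
intros r m Hr [_ Hm].
assert (H := taylor_second_order f a 0 l r m (Cmod u) Ht Hl ltac:(lra)).
specialize (H ltac:(intros z Hz; apply Hm; replace z with (z - 0)%C by ring; trivial) ltac:(lra) u 0 ltac:(lra)
  ltac:(rewrite Cmod_0; lra)).
replace (u - 0)%C with u in H by ring. rewrite Cplus_0_l, Cplus_0_l in H. fold d in H.
assert (0 < r ^ 2) by (apply pow_lt; lra).
apply Rmult_le_reg_l with (6 * Cmod u ^ 2); trivial.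
replace (6 * Cmod u ^ 2 * (d / (6 * Cmod u ^ 2) * r ^ 2)) with (d * r ^ 2) by (field; lra).
apply Rmult_le_compat_r with (r := r ^ 2) in H; [|lra].
replace (6 * m / r ^ 2 * Cmod u * Cmod u * r ^ 2) with (6 * Cmod u ^ 2 * m) in H by (field; lra).
exact H.
Qed.

(** * Geometry of the sectors, and estimates of f and f' on them *)

Lemma Cmod_sqr (z : C) : Cmod z ^ 2 = fst z ^ 2 + snd z ^ 2.
Proof. apply Cmod2_alt. Qed.

Lemma Arg_polar (z : C) : z <> 0 ->
  fst z = Cmod z * cos (Arg z) /\ snd z = Cmod z * sin (Arg z).
Proof.
intro Hz. apply Cmod_gt_0 in Hz. assert (Hs := Cmod_sqr z).
assert (Hr := re_le_Cmod z). unfold Re in Hr. apply Rabs_le_between in Hr.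
assert (Hb : -1 <= fst z / Cmod z <= 1).
{ split; apply Rmult_le_reg_r with (Cmod z); trivial; unfold Rdiv;
  rewrite (Rmult_assoc (fst z)), Rinv_l; lra. }
assert (Hsin : Cmod z * sqrt (1 - (fst z / Cmod z)²) = Rabs (snd z)).
{ rewrite <- (sqrt_Rsqr_abs (snd z)). rewrite <- (sqrt_Rsqr (Cmod z)) at 1 by lra.
  rewrite <- sqrt_mult_alt by apply Rle_0_sqr. f_equal.
  unfold Rsqr. replace (snd z * snd z) with (Cmod z ^ 2 - fst z ^ 2) by (simpl in *; lra). field. lra. }
unfold Arg, Re, Im. destruct (Rle_dec 0 (snd z)) as [Hi|Hi].
- rewrite cos_acos, sin_acos, Hsin, Rabs_pos_eq by (trivial; lra).
  split; [field; lra|reflexivity].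
- rewrite cos_neg, sin_neg, cos_acos, sin_acos by trivial.
  rewrite Ropp_mult_distr_r_reverse, Hsin, Rabs_left by lra. split; [field; lra|ring].
Qed.

Lemma cos_shift_Z x k : cos (x + 2 * PI * IZR k) = cos x.
Proof.
destruct (Z_le_gt_dec 0 k) as [Hk|Hk].
- destruct (IZN k Hk) as [n ->]. rewrite <- INR_IZR_INZ.
  replace (x + 2 * PI * INR n) with (x + 2 * INR n * PI) by ring. apply cos_period.
- destruct (IZN (- k) ltac:(lia)) as [n Hn].
  replace k with (- Z.of_nat n)%Z by lia. rewrite opp_IZR, <- INR_IZR_INZ.
  rewrite <- (cos_period _ n). f_equal. ring.
Qed.

Lemma one_minus_cos_le d : 1 - cos d <= d ^ 2 / 2.
Proof.
replace d with (2 * (d / 2)) at 1 by field. rewrite cos_2a_sin.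
assert (H : Rabs (sin (d / 2)) <= Rabs (d / 2)).
{ assert (Hpos : forall x, 0 <= x -> Rabs (sin x) <= x).
  { intros x Hx. destruct (Req_dec x 0) as [->|Hx0]; [rewrite sin_0, Rabs_R0; lra|].
    apply Rabs_le. destruct (Rle_lt_dec x 1) as [H1|H1].
    - assert (0 <= sin x). { apply sin_ge_0; [lra|]. assert (H := PI2_1). lra. }
      assert (sin x < x) by (apply sin_lt_x; lra). lra.
    - assert (H := SIN_bound x). lra. }
  destruct (Rle_lt_dec 0 (d / 2)) as [H|H].
  - rewrite (Rabs_pos_eq (d / 2)) by trivial. now apply Hpos.
  - rewrite <- Rabs_Ropp, <- sin_neg, (Rabs_left (d / 2)) by trivial. apply Hpos. lra. }
apply Rsqr_le_abs_1 in H. unfold Rsqr in H. simpl. lra.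
Qed.

Lemma exp_small_upper x : 0 <= x <= 1 / 2 -> exp x <= 1 + 2 * x.
Proof.
intros Hx. assert (H := exp_ineq1_le (- x)). rewrite exp_Ropp in H.
assert (He := exp_pos x). apply Rmult_le_compat_r with (r := exp x) in H; [|lra].
rewrite Rinv_l in H by lra. nra.
Qed.

(** Law of cosines. In units of r / N(r), the radial part contributes at most 4^2; the angle is
    below 16 / N(r) and |z| <= 2r, so the angular part contributes at most 512. The sum 528 is below
    23^2. *)
Lemma sector_domain_dist N r zeta z : 0 < r -> Cmod zeta = r -> 4 <= INR (N r) ->
  sector_domain N r zeta z -> Cmod (z - zeta) <= 23 * (r / INR (N r)).
Proof.
intros Hr Hz HN [[H1 H2] [k [_ Hd]]].
set (n := INR (N r)) in *. set (d := Arg z - Arg zeta + 2 * PI * IZR k) in *.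
assert (Hn : 0 < / n <= / 4).
{ split; [apply Rinv_0_lt_compat; lra|apply Rinv_le_contravar; lra]. }
set (i := / n) in *.
assert (E1 : exp (2 / n) <= 1 + 4 * i).
{ unfold Rdiv. fold i. assert (H := exp_small_upper (2 * i)). lra. }
assert (E2 : 1 - 2 * i <= exp (- (2 / n))).
{ unfold Rdiv. fold i. assert (H := exp_ineq1_le (- (2 * i))). lra. }
assert (Hz1 : Cmod z <= r * (1 + 4 * i)) by nra.
assert (Hz2 : r * (1 - 2 * i) <= Cmod z) by nra.
assert (Hz0 : 0 < Cmod z) by nra.
assert (Hsq : Cmod (z - zeta) ^ 2 = (Cmod z - r) ^ 2 + 2 * (Cmod z * r * (1 - cos d))).
{ assert (Hc : cos d = cos (Arg z - Arg zeta)) by apply cos_shift_Z.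
  rewrite Hc, cos_minus, Cmod_sqr.
  destruct (Arg_polar z) as [P1 P2]; [now apply Cmod_gt_0|].
  destruct (Arg_polar zeta) as [P3 P4]; [apply Cmod_gt_0; lra|].
  change (fst (z - zeta)%C) with (fst z - fst zeta). change (snd (z - zeta)%C) with (snd z - snd zeta).
  rewrite P1, P2, P3, P4, Hz.
  assert (T1 := sin2_cos2 (Arg z)). assert (T2 := sin2_cos2 (Arg zeta)). unfold Rsqr in T1, T2.
  set (m := Cmod z) in *.
  set (c1 := cos (Arg z)) in *. set (s1 := sin (Arg z)) in *.
  set (c2 := cos (Arg zeta)) in *. set (s2 := sin (Arg zeta)) in *.
  replace ((m * c1 - r * c2) ^ 2 + (m * s1 - r * s2) ^ 2) with
    (m ^ 2 * (s1 * s1 + c1 * c1) + r ^ 2 * (s2 * s2 + c2 * c2) - 2 * m * r * (c1 * c2 + s1 * s2)) by ring.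
  rewrite T1, T2. ring. }
assert (Hcos := one_minus_cos_le d).
assert (Hd2 : d ^ 2 <= 256 * i ^ 2).
{ replace (256 * i ^ 2) with ((16 * i) ^ 2) by ring. rewrite <- (pow2_abs d).
  apply pow_incr. split; [apply Rabs_pos|].
  apply Rlt_le, (Rlt_le_trans _ _ _ Hd). unfold Rdiv. fold i. assert (H := PI_4). nra. }
assert (Hd0 : 0 <= 1 - cos d) by (assert (H := COS_bound d); lra).
assert (B1 : (Cmod z - r) ^ 2 <= 16 * (r * i) ^ 2).
{ replace (16 * (r * i) ^ 2) with ((4 * (r * i)) ^ 2) by ring.
  rewrite <- (pow2_abs (Cmod z - r)). apply pow_incr. split; [apply Rabs_pos|].
  apply Rabs_le. nra. }
assert (B2 : Cmod z * r * (1 - cos d) <= 256 * (r * i) ^ 2).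
{ apply Rle_trans with ((2 * r * r) * (128 * i ^ 2)).
  - apply Rmult_le_compat; nra.
  - apply Req_le. ring. }
unfold Rdiv. fold i.
assert (Hri : 0 < r * i) by nra.
apply Rsqr_incr_0_var; [|lra]. unfold Rsqr. simpl in Hsq, B1, B2. simpl. nra.
Qed.

(** The number 24 is 23 for the sector plus 1 for a disk of radius r / N(r) around one of its
    points; 24 / N < N^(-2/3) means N > 24^3. *)
Lemma wv_disk_of_dist (N : R -> nat) r zeta w : 0 < r -> 24 ^ 3 < INR (N r) ->
  Cmod (w - zeta) <= 24 * (r / INR (N r)) -> wv_disk N r zeta w.
Proof.
intros Hr HN Hw. unfold wv_disk. apply (Rle_lt_trans _ _ _ Hw).
set (n := INR (N r)) in *. assert (Hn : 0 < n) by (simpl in HN; lra).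
set (s := Rpower n (1 / 3)).
assert (Hs : 0 < s) by apply exp_pos.
assert (E2 : Rpower n (2 / 3) = s * s).
{ unfold s. rewrite <- Rpower_plus. f_equal. field. }
assert (E3 : n = s * s * s).
{ unfold s. rewrite <- !Rpower_plus. rewrite <- (Rpower_1 n) at 1 by trivial. f_equal. field. }
assert (Hs24 : 24 < s).
{ destruct (Rlt_le_dec 24 s) as [H|H]; trivial. exfalso.
  assert (s * s * s <= 24 ^ 3); [|lra].
  replace (s * s * s) with (s ^ 3) by ring. apply pow_incr; lra. }
rewrite E2. rewrite E3.
replace (24 * (r / (s * s * s))) with (r / (s * s) * (24 / s)) by (field; lra).
rewrite <- (Rmult_1_r (r / (s * s))) at 2.
apply Rmult_lt_compat_l.
- apply Rdiv_lt_0_compat; nra.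
- apply Rmult_lt_reg_r with s; trivial. unfold Rdiv. rewrite Rmult_assoc, Rinv_l; lra.
Qed.

Lemma exp_pow x n : exp x ^ n = exp (INR n * x).
Proof.
induction n as [|n IH].
- simpl. rewrite Rmult_0_l, exp_0. reflexivity.
- rewrite S_INR. simpl. rewrite IH, <- exp_plus. f_equal. ring.
Qed.

Lemma Cmod_1_plus_bounds e r : Cmod e <= r -> 1 - r <= Cmod (1 + e) <= 1 + r.
Proof.
intros He. split.
- assert (H := Cmod_triangle (1 + e) (- e)). replace (1 + e + - e)%C with (RtoC 1) in H by ring.
  rewrite Cmod_1, Cmod_opp in H. lra.
- eapply Rle_trans; [apply Cmod_triangle|]. rewrite Cmod_1. lra.
Qed.

(** Both quantities are compared with M(r). On the disk |w| / r <= exp(3/N), hence its N-th power is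
    at most e^3; at z that power is at least e^(-2). The factors 2 and 1/4 come from |eps0| <= 1/2
    and |eps1| < 1/2. *)
Lemma wv_estimates f a M N E eps0 eps1 K R0 r zeta z :
  wiman_valiron f a M N E eps0 eps1 -> radius_choice f M N E eps0 eps1 K R0 ->
  R0 <= r -> ~ E r -> max_modulus_point f M r zeta -> sector_domain N r zeta z ->
  24 ^ 3 < INR (N r) ->
  (forall w, Cmod (w - z) <= r / INR (N r) -> Cmod (f w) <= 2 * exp 3 * M r) /\
  exp (- (2)) / 4 * M r <= Cmod (C_derive f z) * (r / INR (N r)).
Proof.
intros HW HR Hr HE Hz Hs HN.
assert (Hr0 : 0 < r) by (assert (H := rc_pos _ _ _ _ _ _ _ _ HR); lra).
destruct Hz as [Hzr HzM].
assert (HM : 0 <= M r) by (rewrite <- HzM; apply Cmod_ge_0).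
set (n := INR (N r)) in *. assert (Hn : 13824 < n) by (simpl in HN; lra).
assert (Hdist := sector_domain_dist N r zeta z Hr0 Hzr ltac:(fold n; lra) Hs). fold n in Hdist.
assert (Hrn : 0 < r / n) by (apply Rdiv_lt_0_compat; lra).
assert (Hdisk : forall w, Cmod (w - z) <= r / n -> wv_disk N r zeta w).
{ intros w Hw. apply wv_disk_of_dist; trivial. fold n.
  eapply Rle_trans; [apply (Cmod_triangle3 w z zeta)|]. lra. }
assert (Hzeta0 : zeta <> 0) by (apply Cmod_gt_0; lra).
assert (Hf : forall w, wv_disk N r zeta w ->
  Cmod (f w) = (Cmod w / r) ^ N r * M r * Cmod (1 + eps0 r zeta w)).
{ intros w Hw. rewrite (wv_f _ _ _ _ _ _ _ HW r zeta w) by (trivial; now split).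
  rewrite !Cmod_mult, Cmod_pow, Cmod_div, Hzr, HzM by trivial. reflexivity. }
assert (He0 : forall w, wv_disk N r zeta w -> 1 / 2 <= Cmod (1 + eps0 r zeta w) <= 2).
{ intros w Hw.
  destruct (rc_eps0 _ _ _ _ _ _ _ _ HR r zeta w Hr HE (conj Hzr HzM) Hw) as [_ H].
  apply Cmod_1_plus_bounds in H. lra. }
destruct Hs as [[Hs1 Hs2] _]. fold n in Hs1, Hs2.
split.
- intros w Hw. assert (Hwd := Hdisk w Hw). rewrite (Hf w Hwd). specialize (He0 w Hwd).
  assert (Hwm : Cmod w / r <= exp (3 / n)).
  { apply Rmult_le_reg_r with r; trivial. unfold Rdiv at 1. rewrite Rmult_assoc, Rinv_l, Rmult_1_r by lra.
    replace w with ((w - z) + z)%C by ring. eapply Rle_trans; [apply Cmod_triangle|].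
    (* The sector accounts for 2/n and the disk of radius r/n for the additional 1/n. *)
    replace (3 / n) with (2 / n + / n) by (field; lra). rewrite exp_plus.
    assert (Hin : 0 < / n) by (apply Rinv_0_lt_compat; lra).
    assert (E1 := exp_ineq1_le (/ n)). assert (E2 := exp_ineq1_le (2 / n)).
    assert (E3 : 1 <= exp (2 / n)) by (unfold Rdiv in *; lra).
    assert (E4 : exp (2 / n) + / n <= exp (2 / n) * exp (/ n)) by nra.
    assert (E5 : r / n = / n * r) by (unfold Rdiv; ring). nra. }
  assert (Hpow : (Cmod w / r) ^ N r <= exp 3).
  { apply Rle_trans with (exp (3 / n) ^ N r).
    - apply pow_incr. split; trivial. apply Rmult_le_pos; [apply Cmod_ge_0|].
      apply Rlt_le, Rinv_0_lt_compat; lra.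
    - rewrite exp_pow. apply Req_le. f_equal. fold n. field. lra. }
  replace (2 * exp 3 * M r) with (exp 3 * M r * 2) by ring.
  apply Rmult_le_compat; try lra.
  + apply Rmult_le_pos; trivial. apply pow_le. apply Rmult_le_pos; [apply Cmod_ge_0|].
    apply Rlt_le, Rinv_0_lt_compat; lra.
  + apply Rmult_le_compat_r; trivial.
- assert (Hzd : wv_disk N r zeta z).
  { apply Hdisk. replace (z - z)%C with (RtoC 0) by ring. rewrite Cmod_0. lra. }
  rewrite (is_C_derive_unique f z _ (wv_derive_f _ _ _ _ _ _ _ HW r zeta z Hr0 HE (conj Hzr HzM) Hzd)).
  assert (H1 := rc_eps1 _ _ _ _ _ _ _ _ HR r zeta z Hr HE (conj Hzr HzM) Hzd).
  apply Rlt_le, Cmod_1_plus_bounds in H1.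
  rewrite !Cmod_mult, Cmod_div, Cmod_R, Hzr, (Rabs_pos_eq (INR (N r))) by (trivial; apply pos_INR).
  fold n. rewrite (Hf z Hzd). specialize (He0 z Hzd).
  assert (Hpow : exp (- (2)) <= (Cmod z / r) ^ N r).
  { apply Rle_trans with (exp (- (2 / n)) ^ N r).
    - rewrite exp_pow. apply Req_le. f_equal. fold n. field. lra.
    - apply pow_incr. split; [apply Rlt_le, exp_pos|].
      apply Rmult_le_reg_r with r; trivial. unfold Rdiv at 2. rewrite Rmult_assoc, Rinv_l by lra. lra. }
  set (q := (Cmod z / r) ^ N r) in *. set (u := Cmod (1 + eps0 r zeta z)) in *.
  set (v := Cmod (1 + eps1 r zeta z)) in *. assert (He2 := exp_pos (- (2))).
  replace (n / r * (q * M r * u) * v * (r / n)) with ((q * M r) * (u * v)) by (field; lra).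
  replace (exp (- (2)) / 4 * M r) with ((exp (- (2)) * M r) * (1 / 4)) by field.
  apply Rmult_le_compat; nra.
Qed.

(** The point zeta_(n+1) has modulus r_(n+1) and lies in A_(n+1), so r_(n+1) > M(r_n) / e >= K r_n /
    e. This is where the size of K enters. *)
Lemma eremenko_radius_step f a delta M N E eps0 eps1 K R0 r zeta phi n :
  wiman_valiron f a M N E eps0 eps1 -> radius_choice f M N E eps0 eps1 K R0 ->
  eremenko_construction f delta M N E R0 r zeta phi -> delta <> 0 ->
  4 * exp 1 <= K -> 1 <= INR (N (r (S n))) -> r n * 4 <= r (S n).
Proof.
intros HW HR HC Hdelta HK HN.
assert (HR0 := rc_pos _ _ _ _ _ _ _ _ HR).
assert (Hrn := er_radius _ _ _ _ _ _ _ _ _ HC n).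
assert (Hrs := er_radius _ _ _ _ _ _ _ _ _ HC (S n)).
destruct (er_max_modulus _ _ _ _ _ _ _ _ _ HC (S n)) as [Hz _].
assert (HD : eremenko_D N r zeta (S n) (zeta (S n))).
{ set (m := INR (N (r (S n)))) in *.
  assert (Hm : 0 < 2 / m) by (apply Rdiv_lt_0_compat; lra).
  split.
  - rewrite Hz. fold m. assert (H1 := exp_increasing 0 (2 / m) Hm). rewrite exp_0 in H1.
    assert (H2 := exp_increasing (- (2 / m)) 0 ltac:(lra)). rewrite exp_0 in H2. split; nra.
  - exists 0%Z. cbv zeta. fold m. assert (HP := PI_RGT_0).
    replace (Arg (zeta (S n)) - Arg (zeta (S n)) + 2 * PI * 0) with 0 by ring.
    rewrite Rabs_R0. split; [lra|]. apply Rdiv_lt_0_compat; lra. }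
assert (HA : eremenko_A M r (S n) (zeta (S n))).
(* A point belongs to its own |delta|-neighborhood because delta <> 0. *)
{ apply (er_neighborhood_in_A _ _ _ _ _ _ _ _ _ HC (S n)); [lia|].
  exists (zeta (S n)). split; trivial.
  replace (zeta (S n) - zeta (S n))%C with (RtoC 0) by ring. rewrite Cmod_0.
  now apply Cmod_gt_0. }
destruct HA as [HA _]. simpl Nat.pred in HA. rewrite Hz in HA.
assert (Hg := rc_growth _ _ _ _ _ _ _ _ HR (r n) Hrn).
assert (He := exp_pos 1).
assert (HM : K * r n <= M (r n)).
{ apply Rmult_le_compat_r with (r := r n) in Hg; [|lra].
  replace (M (r n) / r n * r n) with (M (r n)) in Hg by (field; lra). exact Hg. }
apply Rlt_le in HA. apply Rmult_le_compat_r with (r := exp 1) in HA; [|lra].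
replace (M (r n) / exp 1 * exp 1) with (M (r n)) in HA by (field; lra).
apply Rmult_le_reg_r with (exp 1); trivial. nra.
Qed.

(* [K] is the constant of the choice of the radius; "sufficiently large,
   depending only on f and delta" is the quantification over [K0]. *)
Theorem theorem3p1 (f : C -> C) (delta : C)
    (hf : entire_transcendental f) (hdelta : delta <> RtoC 0) :
  exists K0 : R, forall K : R, K0 <= K ->
  forall P0 : C2, eremenko_escaping_point f delta K P0 ->
  exists gamma : C -> C2,
    injective_holomorphic_immersion gamma /\
    let Sigma := fun Q : C2 => exists t : C, gamma t = Q in
    Sigma P0 /\
    (forall Q : C2, Sigma Q -> escaping_set (henon f delta) Q) /\
    (forall Q : C2, Sigma Q ->
       exists A lambda : R, 0 < A /\ 0 < lambda < 1 /\
         forall n : nat,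
           norm (minus (Nat.iter n (henon f delta) Q)
                       (Nat.iter n (henon f delta) P0))
           <= A * lambda ^ n).
Proof.
(* Large enough for the radii to grow by a factor 4 at each step. *)
exists (4 * exp 1). intros K HK P0
  (a & M & N & E & eps0 & eps1 & R0 & r & zeta & phi & HW & HR & HC & HP).
destruct hf as [Hent Hpoly].
assert (He := exp_pos 1).
assert (Ht : taylor f a) by apply is_pseries_taylor, (wv_taylor _ _ _ _ _ _ _ HW).
assert (Hd : forall z, cderiv f z (C_derive f z)).
{ intro z. apply is_derive_cderiv. apply C_derive_correct; [exact z|]. now apply Hent. }
assert (HR0 := rc_pos _ _ _ _ _ _ _ _ HR).
assert (Hr0 : forall n, 0 < r n) by (intro n; assert (H := er_radius _ _ _ _ _ _ _ _ _ HC n); lra).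
destruct (central_index_unbounded f a (24 ^ 3 + 1) Ht Hpoly) as [rN HrN].
destruct (max_modulus_quadratic f a _ Ht (Hd 0) Hpoly) as (cM & rM & HcM & HrM).
destruct (proj2 (is_lim_seq_spec r p_infty) (er_unbounded _ _ _ _ _ _ _ _ _ HC) (Rmax rN rM)) as [n1 Hn1].
assert (HNn : forall n, (n1 <= n)%nat -> 24 ^ 3 < INR (N (r n))).
{ intros n Hn. specialize (Hn1 n Hn).
  assert (H : 24 ^ 3 + 1 <= INR (N (r n))); [|lra].
  apply (HrN (r n)); [|apply (wv_central_index _ _ _ _ _ _ _ HW); auto].
  assert (H := Rmax_l rN rM). lra. }
assert (HMn : forall n, (n1 <= n)%nat -> cM * r n ^ 2 <= M (r n)).
{ intros n Hn. specialize (Hn1 n Hn).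
  apply (HrM (r n)); [|apply (wv_max_modulus _ _ _ _ _ _ _ HW); auto].
  assert (H := Rmax_r rN rM). lra. }
destruct (quarter_decay (fun n => / r n) n1) as [Ar [HAr HAr']].
{ intro n. now apply Rlt_le, Rinv_0_lt_compat. }
{ intros n Hn.
  assert (H := eremenko_radius_step _ _ _ _ _ _ _ _ _ _ _ _ _ n HW HR HC hdelta HK).
  assert (H24 := HNn (S n) ltac:(lia)). simpl in H24. specialize (H ltac:(lra)).
  unfold Rdiv. rewrite <- Rinv_mult. apply Rinv_le_contravar; trivial.
  specialize (Hr0 n). lra. }
assert (Hr4 : forall n, 4 ^ n / Ar <= r n).
{ intro n. specialize (HAr' n). specialize (Hr0 n).
  assert (H4 : 0 < 4 ^ n) by (apply pow_lt; lra).
  replace ((1/4) ^ n) with (/ 4 ^ n) in HAr' by (unfold Rdiv; rewrite Rmult_1_l, pow_inv; trivial).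
  apply Rmult_le_reg_r with (Ar * / r n * / 4 ^ n).
  { repeat apply Rmult_lt_0_compat; trivial; now apply Rinv_0_lt_compat. }
  replace (4 ^ n / Ar * (Ar * / r n * / 4 ^ n)) with (/ r n) by (field; lra).
  replace (r n * (Ar * / r n * / 4 ^ n)) with (Ar * / 4 ^ n) by (field; lra). exact HAr'. }
set (F := henon f delta) in *.
(* With second coordinates as x_n, the first coordinate of F^n(P0), which lies in D_n, is
   x_(n+1). *)
set (x := fun n => snd (Nat.iter n F P0) : C).
assert (HxS : forall n, x (S n) = fst (Nat.iter n F P0)) by reflexivity.
assert (Hx : forall n, x (S (S n)) = (f (x (S n)) - delta * x n)%C) by reflexivity.
set (rho := fun n => r n / INR (N (r n))).
assert (Hest : forall n, (n1 <= n)%nat ->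
  (forall w, Cmod (w - x (S n)) <= rho n -> Cmod (f w) <= 2 * exp 3 * M (r n)) /\
  exp (- (2)) / 4 * M (r n) <= Cmod (C_derive f (x (S n))) * rho n).
{ intros n Hn. apply (wv_estimates f a M N E eps0 eps1 K R0 (r n) (zeta n)); trivial.
  - apply (er_radius _ _ _ _ _ _ _ _ _ HC).
  - apply (er_not_exceptional _ _ _ _ _ _ _ _ _ HC).
  - apply (er_max_modulus _ _ _ _ _ _ _ _ _ HC).
  - apply (HP n).
  - now apply HNn. }
assert (He2 := exp_pos (- (2))). assert (He3 := exp_pos 3).
set (b := exp (- (2)) / 4) in *. assert (Hb : 0 < b) by (unfold b; lra).
assert (Hrho : forall n, (n1 <= n)%nat -> 0 < rho n).
{ intros n Hn. apply Rdiv_lt_0_compat; auto. specialize (HNn n Hn). simpl in HNn. lra. }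
assert (HMR : forall n, R0 * K <= M (r n)).
{ intro n. assert (Hrn := er_radius _ _ _ _ _ _ _ _ _ HC n).
  assert (Hg := rc_growth _ _ _ _ _ _ _ _ HR (r n) Hrn).
  apply Rmult_le_compat_r with (r := r n) in Hg; [|apply Rlt_le; auto].
  replace (M (r n) / r n * r n) with (M (r n)) in Hg by (field; specialize (Hr0 n); lra). nra. }
(* The first entry serves |f'| >= b M(r_n) / rho_n >= b cM r_n >= (b cM / Ar) 4^n, where rho_n <=
   r_n; the second serves |f'| rho_n >= b M(r_n) >= b R0 K. *)
set (c := Rmin (b * cM / Ar) (b * (R0 * K))).
assert (Hc : 0 < c).
{ apply Rmin_glb_lt; [apply Rdiv_lt_0_compat; nra|]. apply Rmult_lt_0_compat; trivial. nra. }
destruct (stable_manifold f (C_derive f) a delta x rho (2 * exp 3 / b) c n1 Ht Hd hdelta Hx)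
  as (y & Hy & Hy0 & Hinj & Hder & Hexp); trivial.
{ apply Rlt_le, Rdiv_lt_0_compat; lra. }
{ intros n z Hn Hz. destruct (Hest n Hn) as [H1 H2].
  apply Rle_trans with (1 := H1 z Hz).
  apply Rmult_le_compat_l with (r := 2 * exp 3 / b) in H2; [|apply Rlt_le, Rdiv_lt_0_compat; lra].
  replace (2 * exp 3 / b * (b * M (r n))) with (2 * exp 3 * M (r n)) in H2 by (field; lra).
  exact H2. }
{ intros n Hn. destruct (Hest n Hn) as [_ H2]. specialize (HMn n Hn). specialize (Hrho n Hn).
  specialize (Hr0 n). specialize (Hr4 n). specialize (HNn n Hn). simpl in HNn.
  assert (H4 : 0 < 4 ^ n) by (apply pow_lt; lra).
  assert (Hrr : rho n <= r n).
  { unfold rho. apply Rmult_le_reg_r with (INR (N (r n))); [lra|].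
    unfold Rdiv. rewrite Rmult_assoc, Rinv_l by lra. nra. }
  assert (Hc1 : c <= b * cM / Ar) by apply Rmin_l.
  apply Rle_trans with (b * cM * r n).
  { apply Rle_trans with (b * cM / Ar * 4 ^ n); [apply Rmult_le_compat_r; lra|].
    replace (b * cM / Ar * 4 ^ n) with (b * cM * (4 ^ n / Ar)) by (unfold Rdiv; ring).
    apply Rmult_le_compat_l; nra. }
  assert (Hq := Cmod_ge_0 (C_derive f (x (S n)))).
  apply Rmult_le_reg_r with (r n); trivial.
  apply Rle_trans with (b * M (r n)); [|nra].
  replace (b * cM * r n * r n) with (b * (cM * r n ^ 2)) by ring.
  apply Rmult_le_compat_l; lra. }
{ intros n Hn. destruct (Hest n Hn) as [_ H2].
  assert (Hc2 : c <= b * (R0 * K)) by apply Rmin_r. specialize (HMR n).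
  apply Rle_trans with (b * M (r n)); [|exact H2].
  apply Rle_trans with (1 := Hc2). apply Rmult_le_compat_l; lra. }
set (gamma := fun t => (y t 1%nat, y t 0%nat) : C2).
assert (Hiter : forall t n, Nat.iter n F (gamma t) = (y t (S n), y t n)).
{ intros t n. induction n as [|n IH]; [reflexivity|].
  change (Nat.iter (S n) F (gamma t)) with (F (Nat.iter n F (gamma t))). rewrite IH.
  unfold F, henon. simpl. now rewrite Hy. }
assert (HiterP : forall n, Nat.iter n F P0 = (x (S n), x n)) by (intro n; apply surjective_pairing).
exists gamma. split; [split|split; [|split]].
- intros s t Hst. apply Hinj.
  + apply (f_equal snd Hst).
  + apply (f_equal fst Hst).
- intro t. destruct (Hder t) as (v0 & v1 & H0 & H1 & Hv).
  exists (v1, v0). split; [now apply cderiv_pair_is_derive|].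
  intro Hz. apply Hv. split; [apply (f_equal snd Hz)|apply (f_equal fst Hz)].
- exists 0. unfold gamma. rewrite !Hy0. symmetry. apply (HiterP 0%nat).
- intros Q [t <-]. unfold escaping_set.
  destruct (Hexp t) as (A & HA & HA').
  (* Since x_(n+1) lies in D_n, its modulus is at least r_n exp(-2/N) >= r_n / 2, and y_(n+1) is
     within A of it. *)
  apply (is_lim_seq_le_p_loc (fun n => r n / 2 - A)).
  + exists n1. intros n Hn. cbv beta. rewrite Hiter.
    apply Rle_trans with (Cmod (y t (S n))).
    2:{ unfold norm; simpl. unfold prod_norm; simpl.
      change (Cmod (y t (S n)) <= sqrt (Cmod (y t (S n)) * (Cmod (y t (S n)) * 1) + Cmod (y t n) * (Cmod (y t n) * 1))).
      assert (Hu := Cmod_ge_0 (y t (S n))). rewrite <- (sqrt_Rsqr (Cmod (y t (S n)))) at 1 by trivial.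
      apply sqrt_le_1_alt. unfold Rsqr. assert (Hw := Cmod_ge_0 (y t n)). nra. }
    specialize (HA' (S n)). specialize (HNn n Hn). simpl in HNn.
    assert (Hq : (1/4) ^ S n <= 1).
    { apply Rle_trans with (1 ^ S n); [apply pow_incr; lra|rewrite pow1; lra]. }
    destruct (proj1 (HP n)) as [[Hlow _] _]. rewrite <- HxS in Hlow.
    assert (Hexpl := exp_ineq1_le (- (2 / INR (N (r n))))).
    assert (Hin : 2 / INR (N (r n)) <= 1 / 2).
    { apply Rmult_le_reg_r with (INR (N (r n))); [lra|]. unfold Rdiv. rewrite Rmult_assoc, Rinv_l by lra. lra. }
    specialize (Hr0 n).
    assert (Htri := Cmod_triangle (y t (S n)) (- (y t (S n) - x (S n)))).
    replace (y t (S n) + - (y t (S n) - x (S n)))%C with (x (S n)) in Htri by ring.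
    rewrite Cmod_opp in Htri. nra.
  + apply is_lim_seq_spec. intro B.
    destruct (proj2 (is_lim_seq_spec r p_infty) (er_unbounded _ _ _ _ _ _ _ _ _ HC) (2 * (B + A))) as [n2 Hn2].
    exists n2. intros n Hn. specialize (Hn2 n Hn). lra.
- intros Q [t <-]. destruct (Hexp t) as (A & HA & HA').
  (* The Euclidean norm is at most the sum of the two coordinate errors, A 4^(-n-1) and A 4^(-n). *)
  exists (2 * A), (1/4). split; [lra|]. split; [lra|]. intro n.
  rewrite Hiter, HiterP.
  assert (H1 := HA' (S n)). assert (H2 := HA' n).
  assert (Hq : 0 < (1/4) ^ n) by (apply pow_lt; lra). simpl ((1/4) ^ S n) in H1.
  set (u := (y t (S n) - x (S n))%C) in *. set (w := (y t n - x n)%C) in *.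
  change (sqrt (Cmod u ^ 2 + Cmod w ^ 2) <= 2 * A * (1/4) ^ n).
  assert (Hu := Cmod_ge_0 u). assert (Hw := Cmod_ge_0 w).
  apply Rle_trans with (Cmod u + Cmod w).
  + rewrite <- (sqrt_Rsqr (Cmod u + Cmod w)) by lra.
    apply sqrt_le_1_alt. unfold Rsqr. nra.
  + nra.
Qed.
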